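(* Let $k,n,r\ge1$ be integers, $\mathbb I=[-1,1]$, and let $\mathfrak B$ be a finite set. Let $(f_{\mathfrak b,a})_{\mathfrak b\in\mathfrak B}$ be an IFS with parameter $a\in\mathbb I^k$ of class $C^r$ on $\mathbb R^n$, and let $a_0\in\mathbb I^k$. Then the set $$J^r_{a_0}\Lambda=\{J^r_{a_0}X(\underline{\mathfrak b}):\underline{\mathfrak b}\in\mathfrak B^{\mathbb Z^-}\}$$ is the limit set of the IFS $(\widehat f_{\mathfrak b})_{\mathfrak b\in\mathfrak B}$ acting on the $r$-jet space $J^r_{a_0}(\mathbb I^k,\mathbb R^n)$, that is, $$J^r_{a_0}\Lambda=\Big\{\lim_{m\to+\infty}\widehat f_{\mathfrak b_{-1}}\circ\cdots\circ\widehat f_{\mathfrak b_{-m}}(0)\ :\ (\mathfrak b_i)_{i\le -1}\in\mathfrak B^{\mathbb Z^-}\Big\}.$$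
   Context: An IFS (iterated functions system) with parameter is a finite collection of families $(f_{\mathfrak b,a})_{\mathfrak b\in\mathfrak B}$ of contracting maps of $\mathbb R^n$ (Lipschitz with constant $<1$) depending on $a\in\mathbb I^k$; it is of class $C^r$ if for each $\mathfrak b$ the map $(a,x)\mapsto f_{\mathfrak b,a}(x)$ belongs to $C^r(\mathbb I^k\times\mathbb R^n,\mathbb R^n)$. Sequences in $\mathfrak B^{\mathbb Z^-}$ are written $\underline{\mathfrak b}=(\mathfrak b_i)_{i\le-1}$. For $a\in\mathbb I^k$ and $\underline{\mathfrak b}\in\mathfrak B^{\mathbb Z^-}$, set $X_a(\underline{\mathfrak b})=\lim_{m\to+\infty}f_{\mathfrak b_{-1},a}\circ\cdots\circ f_{\mathfrak b_{-m},a}(0)$. For each $\underline{\mathfrak b}$ the function $a\mapsto X_a(\underline{\mathfrak b})$ is of class $C^r$, and $J^r_{a_0}X(\underline{\mathfrak b})=(X_a(\underline{\mathfrak b}),\partial_aX_a(\underline{\mathfrak b}),\dots,\partial_a^rX_a(\underline{\mathfrak b}))_{|a=a_0}$ denotes its $r$-jet at $a_0$. The jet space $J^r_{a_0}(\mathbb I^k,\mathbb R^n)$ is the finite-dimensional vector space of Taylor series $(x_a,\partial_ax_a,\dots,\partial_a^rx_a)_{|a=a_0}$ at $a_0$ of functions $a\mapsto x_a$ in $C^r(\mathbb I^k,\mathbb R^n)$. A family $(f_a)_a\in C^r(\mathbb I^k\times\mathbb R^n,\mathbb R^n)$ acts on it by $$\widehat f:(x_a,\partial_ax_a,\dots,\partial^r_ax_a)_{|a=a_0}\mapsto(f_a(x_a),\partial_a(f_a(x_a)),\dots,\partial_a^r(f_a(x_a)))_{|a=a_0},$$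 and $\widehat f_{\mathfrak b}$ is the map obtained in this way from $(f_{\mathfrak b,a})_a$. *)

(* Defs.v *)
From HB Require Import structures.
From mathcomp Require Import all_boot all_order all_algebra.
From mathcomp Require Import all_classical all_reals all_analysis.

Set Implicit Arguments.
Unset Strict Implicit.
Unset Printing Implicit Defensive.

Import Order.TTheory GRing.Theory Num.Theory.
Import numFieldNormedType.Exports.

Local Open Scope classical_set_scope.
Local Open Scope ring_scope.

Section PartialDerivatives.
Context {R : realType} {d n : nat}.
Implicit Types (D : set 'rV[R]_d) (g : 'rV[R]_d -> 'rV[R]_n) (p : 'rV[R]_d).

(* Increments are restricted to those keeping the point in D, so that on a
   closed box D the derivative is one-sided at boundary points and depends only
   on the values of g on D. The definitions below are meant for D a product of
   nondegenerate intervals, where every point of D admits such increments along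
   every coordinate axis. *)
Definition pquotient D (i : 'I_d) g p : set_system 'rV[R]_n :=
  h^-1 *: (g (p + h *: delta_mx 0 i) - g p)
    @[h --> within [set h : R | D (p + h *: delta_mx 0 i)] 0^'].

Definition pderiv D (i : 'I_d) g : 'rV[R]_d -> 'rV[R]_n :=
  fun p => lim (pquotient D i g p).

Definition pderivs D (s : seq 'I_d) g : 'rV[R]_d -> 'rV[R]_n :=
  foldr (pderiv D) g s.

Fixpoint Cr (r : nat) D g : Prop :=
  {within D, continuous g} /\
  if r is r'.+1 then
    forall i, (forall p, D p -> cvg (pquotient D i g p)) /\ Cr r' D (pderiv D i g)
  else True.

End PartialDerivatives.

Definition enorm (R : realType) (n : nat) (x : 'rV[R]_n) : R :=
  Num.sqrt (\sum_i x 0 i ^+ 2).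

(* The library's [is_contraction] refers to the sup norm of 'rV[R]_n, hence this
   Euclidean version. *)
Definition contracting (R : realType) (n : nat) (g : 'rV[R]_n -> 'rV[R]_n) :=
  exists2 c : R, c < 1 & forall x y, enorm (g x - g y) <= c * enorm (x - y).

Section IteratedFunctionSystems.
Context {B : Type} {T : Type}.

(* A sequence (b_i)_{i <= -1} is encoded as b : nat -> B, where b m stands for
   b_{-(m+1)}; thus [branch F b x m] is F b_{-1} (F b_{-2} (... (F b_{-m} x))). *)
Definition branch (F : B -> T -> T) (b : nat -> B) (x : T) (m : nat) : T :=
  foldr (fun i => F (b i)) x (iota 0 m).

End IteratedFunctionSystems.

Definition limit_set (B : Type) (T : topologicalType) (F : B -> T -> T) (x : T) :
    set T :=
  [set l | exists b : nat -> B, branch F b x m @[m --> \oo] --> l].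

Definition cube (R : realType) (k : nat) : set 'rV[R]_k :=
  [set a | forall i, a 0 i \in `[-1, 1]].
Arguments cube R k : clear implicits.

Section ParametrizedIFS.
Context {R : realType} {k n : nat}.

(* Only the values at parameters in the cube are ever used. *)
Definition Cr_family (r : nat) (f : 'rV[R]_k -> 'rV[R]_n -> 'rV[R]_n) : Prop :=
  Cr r [set p : 'rV[R]_(k + n) | cube R k (lsubmx p)]
    (fun p => f (lsubmx p) (rsubmx p)).

Definition parametrized_IFS (B : finType) (r : nat)
    (f : B -> 'rV[R]_k -> 'rV[R]_n -> 'rV[R]_n) : Prop :=
  (forall b, Cr_family r (f b)) /\
  (forall b a, cube R k a -> contracting (f b a)).

Definition Xlim (B : finType) (f : B -> 'rV[R]_k -> 'rV[R]_n -> 'rV[R]_n)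
    (b : nat -> B) (a : 'rV[R]_k) : 'rV[R]_n :=
  lim (branch (fun c => f c a) b 0 m @[m --> \oo]).

End ParametrizedIFS.

Definition jet_index (k r : nat) : finType := {j : 'I_r.+1 & j.-tuple 'I_k}.

(* The rows are indexed by the words (i_1, ..., i_j) over 'I_k with j <= r; those
   with a given j are the coordinates, in the canonical basis, of a j-linear map
   from R^k to R^n. *)
Notation jet_array R k n r := 'M[R]_(#|jet_index k r|, n).

Section Jets.
Context {R : realType} {k n : nat} (r : nat) (a0 : 'rV[R]_k).

Definition jet (x : 'rV[R]_k -> 'rV[R]_n) : jet_array R k n r :=
  \matrix_(s < #|jet_index k r|) pderivs (cube R k) (tagged (enum_val s)) x a0.

Definition jet_space : set (jet_array R k n r) :=
  [set jet x | x in [set x | Cr r (cube R k) x]].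

Definition jet_repr (J : jet_array R k n r) : 'rV[R]_k -> 'rV[R]_n :=
  xget (fun=> 0) [set x | Cr r (cube R k) x /\ jet x = J].

(* By the chain rule the value does not depend on the representative, for f of
   class C^r; only the restriction of the map to [jet_space] is meaningful. *)
Definition jet_action (f : 'rV[R]_k -> 'rV[R]_n -> 'rV[R]_n) (J : jet_array R k n r) :
    jet_array R k n r :=
  jet (fun a => f a (jet_repr J a)).

Definition jet_Lambda (B : finType) (f : B -> 'rV[R]_k -> 'rV[R]_n -> 'rV[R]_n) :
    set (jet_array R k n r) :=
  [set jet (Xlim f b) | b in [set: nat -> B]].

End Jets.

Arguments jet {R k n} r a0 x.
Arguments jet_space {R k n} r a0.
Arguments jet_repr {R k n} r a0 J.
Arguments jet_action {R k n} r a0 f J.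
Arguments jet_Lambda {R k n} r a0 {B} f.

(* Main.v *)
Require Import Defs.
From mathcomp Require Import all_boot all_order all_algebra.
From mathcomp Require Import all_classical all_reals all_analysis.
From mathcomp Require Import ring lra.
Import Order.TTheory GRing.Theory Num.Theory.
Import numFieldNormedType.Exports.
Local Open Scope classical_set_scope.
Local Open Scope ring_scope.

Set Implicit Arguments.
Unset Strict Implicit.
Unset Printing Implicit Defensive.

(* The iterate of order m of the jet maps at 0 is the jet of the function
   X_m(b) : a |-> f_{b_{-1},a} o ... o f_{b_{-m},a} (0), so it suffices that all
   partial derivatives of order at most r of X_m(b) converge locally uniformly on
   the cube. Near a given parameter the maps f_{b,a} preserve a common ball and
   are uniformly contracting on it, by compactness; this gives the convergence of
   X_m(b). For a word s of positive length, the chain rule yields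
     d_s X_{m+1}(b) = d_s X_m(shift b) . D_x f_{b_{-1}} (X_m(shift b)) + (lower terms),
   where the lower terms are polynomial in derivatives of f along X_m(shift b) and
   in derivatives of X_m(shift b) of order < |s|, hence converge uniformly by
   induction. Such an affine recursion with uniformly contracting linear part and
   converging coefficients converges uniformly. *)

(** * Matrices, iterated partial derivatives and the Euclidean norm *)

(** The jet maps need not contract any obvious norm of the jet space: [D_x f] contracts each block
    of derivatives of a given order, but the coupling with the lower orders can be large. Moreover
    the derivatives of order [r] of the maps are merely continuous, so that the jet maps are in
    general not Lipschitz. Hence the limit is not obtained from a fixed point theorem on jets, but
    order by order, from Cauchy estimates without a rate for the derivatives.

    Two uniformities shape the statements. The recursion passes from [b] to its shift, so every
    estimate must hold for all sequences at once. And convergence at [a0] alone would not identify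
    the limit of the derivatives with the derivative of the limit: a neighbourhood of [a0] in the
    cube is needed, with derivatives that are one-sided on the faces. The contraction constant may
    depend on the parameter without any regularity, so a common constant near [a0] has to be
    recovered from the [C^1] bounds. *)

Section Matrices.
Context {R : realType}.

Lemma cvg_sumR (T I : Type) (F : set_system T) {FF : Filter F} (r : seq I)
    (u : I -> T -> R) (l : I -> R) : (forall i, u i @ F --> l i) ->
  \sum_(i <- r) u i t @[t --> F] --> \sum_(i <- r) l i.
Proof.
move=> ul; elim: r => [|i r IH].
  by under eq_fun do rewrite big_nil; rewrite big_nil; exact: cvg_cst.
by under eq_fun do rewrite big_cons; rewrite big_cons; apply: cvgD.
Qed.

Lemma cvg_mxP (T : Type) (F : set_system T) {FF : Filter F} (m n : nat)
    (u : T -> 'M[R]_(m, n)) (v : 'M[R]_(m, n)) :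
  u @ F --> v <-> forall i j, u t i j @[t --> F] --> v i j.
Proof.
split => [uv i j|uv].
  exact: (cvg_comp u (fun M : 'M[R]_(m, n) => M i j) uv (@coord_continuous _ _ _ i j v)).
apply/cvg_ballP => e e0.
have : forall i : 'I_m, \forall t \near F, forall j, ball (v i j) e (u t i j).
  move=> i; apply: filter_forall => j.
  by have /cvg_ballP/(_ e e0) := uv i j.
move/filter_forall; apply: filterS => t H; split => // i j; exact: H.
Qed.

Lemma nbhs_rVP (n : nat) (x : 'rV[R]_n) (P : set 'rV[R]_n) :
  nbhs x P <-> exists2 d : R, 0 < d &
    forall y : 'rV[R]_n, (forall j, `|y 0 j - x 0 j| < d) -> P y.
Proof.
split => [/nbhs_ballP[d /= d0 H]|[d d0 H]].
  exists d => // y yx; apply: H; split => // i j; rewrite ord1.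
  by rewrite /ball /= distrC; exact: yx.
apply/nbhs_ballP; exists d => //= y [_ yx]; apply: H => j.
by have := yx 0 j; rewrite /ball /= distrC.
Qed.

End Matrices.

Section Words.
Context {R : realType} {d n : nat}.
Implicit Types (D : set 'rV[R]_d) (g : 'rV[R]_d -> 'rV[R]_n).

Lemma Cr_pderivs r D g s : Cr r D g -> (size s <= r)%N ->
  Cr (r - size s) D (pderivs D s g).
Proof.
move=> gr; elim: s => [|i s IH] /=; first by rewrite subn0.
move=> sr; have := IH (ltnW sr); rewrite subnS.
by case: (r - size s)%N (subn_gt0 (size s) r) => [|q _ /= [_ /(_ i)[]//]]; rewrite sr.
Qed.

Lemma CrP r D g : Cr r D g <->
  (forall s, (size s <= r)%N -> {within D, continuous (pderivs D s g)}) /\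
  (forall s i p, (size s < r)%N -> D p -> cvg (pquotient D i (pderivs D s g) p)).
Proof.
split=> [gr|].
  split=> [s sr|s i p sr Dp].
    by have := Cr_pderivs gr sr; case: (r - _)%N => [|?] [].
  have := Cr_pderivs gr (ltnW sr).
  case: (r - size s)%N (subn_gt0 (size s) r) => [|q _ /= [_ /(_ i)[+ _]]].
    by rewrite sr.
  exact.
elim: r g => [|r IH] g [gc gd].
  by split => //; exact: (gc [::]).
split; first exact: (gc [::]).
move=> i; split => [p Dp|]; first exact: (gd [::] i p).
apply: IH; split => [s sr|s j p sr Dp].
  (* [Cr] peels off the derivative that is taken first, which is the last letter of the word. *)
  by have := gc (rcons s i); rewrite size_rcons /pderivs foldr_rcons; exact.
by have := gd (rcons s i) j p; rewrite size_rcons /pderivs foldr_rcons; exact.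
Qed.

End Words.

Section EuclideanNorm.
Context {R : realType} {n : nat}.
Implicit Types x y z : 'rV[R]_n.

Lemma enorm_ge0 x : 0 <= enorm x.
Proof. exact: sqrtr_ge0. Qed.

Lemma sumsq_ge0 x : 0 <= \sum_i x 0 i ^+ 2.
Proof. by apply: sumr_ge0 => i _; exact: sqr_ge0. Qed.

Lemma sqr_enorm x : enorm x ^+ 2 = \sum_i x 0 i ^+ 2.
Proof. by rewrite sqr_sqrtr // sumsq_ge0. Qed.

Lemma enormZ a x : enorm (a *: x) = `|a| * enorm x.
Proof.
rewrite /enorm -sqrtr_sqr -sqrtrM ?sqr_ge0 // mulr_sumr.
by congr (Num.sqrt _); apply: eq_bigr => i _; rewrite mxE exprMn.
Qed.

Lemma enorm0 : enorm (0 : 'rV[R]_n) = 0.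
Proof. by rewrite -[0](scale0r (0 : 'rV[R]_n)) enormZ normr0 mul0r. Qed.

Lemma enormN x : enorm (- x) = enorm x.
Proof. by rewrite -scaleN1r enormZ normrN1 mul1r. Qed.

Lemma enormB x y : enorm (x - y) = enorm (y - x).
Proof. by rewrite -enormN opprB. Qed.

(** Cauchy-Schwarz through Lagrange's identity: twice the defect is the sum of the squares of all 2
    x 2 minors of the pair [x], [y]. *)
Lemma dot_le_enorm x y : \sum_i x 0 i * y 0 i <= enorm x * enorm y.
Proof.
apply: le_trans (ler_norm _) _; rewrite -ler_sqr ?nnegrE ?mulr_ge0 ?enorm_ge0 //.
rewrite real_normK ?num_real // exprMn !sqr_enorm.
rewrite -subr_ge0 -(pmulr_rge0 _ (ltr0n R 2)).
suff -> : 2 * ((\sum_i x 0 i ^+ 2) * (\sum_i y 0 i ^+ 2) -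
              (\sum_i x 0 i * y 0 i) ^+ 2) =
   \sum_i \sum_j (x 0 i * y 0 j - x 0 j * y 0 i) ^+ 2.
  by do 2!(apply: sumr_ge0 => ? _); exact: sqr_ge0.
under [RHS]eq_bigr => i _ do (under eq_bigr => j _ do
  (have -> : (x 0 i * y 0 j - x 0 j * y 0 i) ^+ 2 =
    x 0 i ^+ 2 * y 0 j ^+ 2 + y 0 i ^+ 2 * x 0 j ^+ 2
      - 2 * (x 0 i * y 0 i) * (x 0 j * y 0 j) by ring);
  rewrite sumrB big_split /= -!mulr_sumr).
by rewrite sumrB big_split /= -!mulr_suml -mulr_sumr; ring.
Qed.

Lemma ler_enormD x y : enorm (x + y) <= enorm x + enorm y.
Proof.
rewrite -ler_sqr ?nnegrE ?addr_ge0 ?enorm_ge0 // sqr_enorm.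
under eq_bigr => i _ do rewrite mxE sqrrD.
rewrite !big_split /= -!sqr_enorm sqrrD lerD2r lerD2l -mulr2n.
by rewrite lerMn2r //= dot_le_enorm.
Qed.

Lemma ler_enormB x y : enorm (x - y) <= enorm x + enorm y.
Proof. by rewrite -(enormN y) ler_enormD. Qed.

Lemma ler_enorm_dist x y z : enorm (x - z) <= enorm (x - y) + enorm (y - z).
Proof. by rewrite -{1}(subrKA y) ler_enormD. Qed.

Lemma coord_le_enorm x j : `|x 0 j| <= enorm x.
Proof.
rewrite -sqrtr_sqr ler_wsqrtr // (bigD1 j) //= lerDl.
by apply: sumr_ge0 => i _; exact: sqr_ge0.
Qed.

Lemma enorm_le_sum x : enorm x <= \sum_j `|x 0 j|.
Proof.
have s0 : 0 <= \sum_j `|x 0 j| by apply: sumr_ge0.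
rewrite -ler_sqr ?nnegrE ?enorm_ge0 // sqr_enorm expr2 mulr_suml.
apply: ler_sum => j _.
rewrite -(real_normK (num_real (x 0 j))) expr2 ler_wpM2l //.
by rewrite (bigD1 j) //= lerDl sumr_ge0.
Qed.

Lemma sum_le_enorm x : \sum_j `|x 0 j| <= n%:R * enorm x.
Proof.
apply: (@le_trans _ _ (\sum_(j < n) enorm x)).
  by apply: ler_sum => j _; exact: coord_le_enorm.
by rewrite sumr_const card_ord mulr_natl.
Qed.

Lemma cvg_enorm (T : Type) (F : set_system T) {FF : Filter F}
    (u : T -> 'rV[R]_n) x :
  u @ F --> x -> enorm (u t) @[t --> F] --> enorm x.
Proof.
move=> /cvg_mxP ux; apply: (@continuous_cvg _ _ _ _ _ _ Num.sqrt).
  exact: sqrt_continuous.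
apply: cvg_sumR => i; rewrite [fun t => _](_ : _ = fun t => u t 0 i * u t 0 i).
  by rewrite expr2; apply: cvgM; exact: ux.
by apply/funext => t; rewrite expr2.
Qed.

Lemma compact_eball (rho : R) : compact [set x : 'rV[R]_n | enorm x <= rho].
Proof.
apply: (subclosed_compact _ (@rV_compact _ n (fun=> `[- rho, rho]%classic) _)).
- apply: (@closed_comp _ R (@enorm R n) [set t | t <= rho]); last exact: closed_le.
  by move=> x _; exact: (@cvg_enorm _ (nbhs x) _ id x cvg_id).
- by move=> i; exact: segment_compact.
- move=> x /= xr i; rewrite in_itv /= -ler_norml.
  exact: le_trans (coord_le_enorm _ _) xr.
Qed.

End EuclideanNorm.

(** * One-sided partial derivatives *)

Section PartialDerivatives.
Context {R : realType} {d : nat}.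
Implicit Types (D : set 'rV[R]_d) (g : 'rV[R]_d -> R) (p q : 'rV[R]_d).

Definition is_pderiv D (i : 'I_d) g p (l : R) : Prop :=
  h^-1 * (g (p + h *: delta_mx 0 i) - g p)
    @[h --> within [set h : R | D (p + h *: delta_mx 0 i)] 0^'] --> l.

Definition cont_on D g : Prop :=
  forall p, D p -> g q @[q --> within D (nbhs p)] --> g p.

(** Only segments parallel to a coordinate axis matter, as the mean value theorem is applied along
    these alone. *)
Definition axis_convex D : Prop := forall p i h t,
  D p -> D (p + h *: delta_mx 0 i) -> 0 <= t <= 1 ->
  D (p + (t * h) *: delta_mx 0 i).

(** This makes the filter of admissible nonzero increments proper, hence partial derivatives
    unique. *)
Definition axis_thick D : Prop := forall p i (e : R), D p -> 0 < e ->
  exists h : R, [/\ h != 0, `|h| < e & D (p + h *: delta_mx 0 i)].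

Lemma quotient_dist_le (h a l e : R) : h != 0 ->
  (`|l - h^-1 * a| <= e) = (`|a - h * l| <= e * `|h|).
Proof.
move=> h0; rewrite distrC -[X in _ - X](mulKf h0) -mulrBr.
by rewrite normrM normfV ler_pdivrMl ?normr_gt0 // [e * _]mulrC.
Qed.

(** Form without division: [h = 0] becomes admissible, since both sides of the inequality then
    vanish. *)
Lemma is_pderivP D i g p l : is_pderiv D i g p l <->
  forall e : R, 0 < e -> exists2 del : R, 0 < del &
    forall h, `|h| < del -> D (p + h *: delta_mx 0 i) ->
      `|g (p + h *: delta_mx 0 i) - g p - h * l| <= e * `|h|.
Proof.
rewrite /is_pderiv cvgrPdist_le; split => H e e0.
  have /nbhs_ballP[del /= del0 Hd] := H e e0.
  exists del => // h hd Dh; have [->|h0] := eqVneq h 0.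
    by rewrite scale0r addr0 mul0r subrr subr0 normr0 mulr0.
  by rewrite -quotient_dist_le //; apply: Hd => //; rewrite /ball /= sub0r normrN.
have [del del0 Hd] := H e e0.
apply/nbhs_ballP; exists del => //= h; rewrite /ball /= sub0r normrN => hd h0 Dh.
by rewrite quotient_dist_le // Hd.
Qed.

Lemma within_axis_proper D i p : axis_thick D -> D p ->
  ProperFilter (within [set h : R | D (p + h *: delta_mx 0 i)] 0^').
Proof.
move=> DT Dp; apply: Build_ProperFilter_ex.
move=> P /nbhs_ballP[del /= del0 Hd].
have [h [h0 hd Dh]] := DT p i del Dp del0; exists h.
by apply: Hd => //; rewrite /ball /= sub0r normrN.
Qed.

Lemma is_pderiv_unique D i g p l1 l2 : axis_thick D -> D p ->
  is_pderiv D i g p l1 -> is_pderiv D i g p l2 -> l1 = l2.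
Proof.
move=> DT Dp; have PF := within_axis_proper i DT Dp.
exact: cvg_unique.
Qed.

Lemma eq_is_pderiv D i g1 g2 p l : (forall q, D q -> g1 q = g2 q) -> D p ->
  is_pderiv D i g1 p l -> is_pderiv D i g2 p l.
Proof.
move=> g12 Dp /is_pderivP H; apply/is_pderivP => e e0.
have [del del0 Hd] := H e e0; exists del => // h hd Dh.
by rewrite -!g12 //; exact: Hd.
Qed.

Lemma is_pderiv_cst D i (c : R) p : is_pderiv D i (fun=> c) p 0.
Proof.
rewrite /is_pderiv; under eq_fun do rewrite subrr mulr0; exact: cvg_cst.
Qed.

Lemma is_pderivD D i g1 g2 p l1 l2 : is_pderiv D i g1 p l1 ->
  is_pderiv D i g2 p l2 -> is_pderiv D i (fun q => g1 q + g2 q) p (l1 + l2).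
Proof.
rewrite /is_pderiv => H1 H2.
by under eq_fun do rewrite opprD addrACA mulrDr; apply: cvgD.
Qed.

Lemma is_pderiv_cvg D i g p l : is_pderiv D i g p l ->
  g (p + h *: delta_mx 0 i)
    @[h --> within [set h : R | D (p + h *: delta_mx 0 i)] 0^'] --> g p.
Proof.
move=> /is_pderivP/(_ 1 ltr01)[del del0 Hd].
apply/cvgrPdist_le => e e0; apply/nbhs_ballP.
(* The estimate with error 1 bounds the increment of [g] by [(1 + |l|) * |h|]. *)
exists (Num.min del (e / (1 + `|l|))) => /=.
  by rewrite lt_min del0 divr_gt0 // ltr_pwDl.
move=> h; rewrite /ball /= sub0r normrN lt_min => /andP[hd he] _ Dh.
rewrite distrC -(subrK (h * l) (_ - _)); apply: le_trans (ler_normD _ _) _.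
apply: le_trans (lerD (Hd h hd Dh) (lexx _)) _.
rewrite normrM [`|h| * _]mulrC -mulrDl mulrC -ler_pdivlMr ?ltr_pwDl //.
exact: ltW.
Qed.

Lemma is_pderivM D i g1 g2 p l1 l2 : is_pderiv D i g1 p l1 ->
  is_pderiv D i g2 p l2 ->
  is_pderiv D i (fun q => g1 q * g2 q) p (l1 * g2 p + g1 p * l2).
Proof.
move=> H1 H2; have C2 := is_pderiv_cvg H2.
have E (a1 a2 b1 b2 c : R) :
  c * (a1 * a2 - b1 * b2) = c * (a1 - b1) * a2 + b1 * (c * (a2 - b2)) by ring.
rewrite /is_pderiv; under eq_fun do rewrite E.
by apply: cvgD; apply: cvgM => //; exact: cvg_cst.
Qed.

Lemma cont_onD D g1 g2 : cont_on D g1 -> cont_on D g2 ->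
  cont_on D (fun q => g1 q + g2 q).
Proof. by move=> H1 H2 p Dp; apply: cvgD; [exact: H1|exact: H2]. Qed.

Lemma cont_onM D g1 g2 : cont_on D g1 -> cont_on D g2 ->
  cont_on D (fun q => g1 q * g2 q).
Proof. by move=> H1 H2 p Dp; apply: cvgM; [exact: H1|exact: H2]. Qed.

Lemma eq_cont_on D g1 g2 : (forall q, D q -> g1 q = g2 q) ->
  cont_on D g1 -> cont_on D g2.
Proof.
move=> g12 H p Dp; rewrite -g12 //; apply: cvg_trans (H p Dp).
apply: near_eq_cvg; apply: filterS (withinT D (nbhs_filter p)) => q Dq.
exact: g12.
Qed.

Lemma cont_onP D g : cont_on D g <-> forall p, D p -> forall e : R, 0 < e ->
  exists2 del : R, 0 < del & forall q, D q -> (forall j, `|q 0 j - p 0 j| < del) ->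
    `|g q - g p| <= e.
Proof.
split => H p Dp.
  move=> e e0; have /cvgrPdist_le/(_ e e0) /nbhs_rVP[del del0 Hd] := H p Dp.
  by exists del => // q Dq qp; rewrite distrC; exact: Hd.
apply/cvgrPdist_le => e e0; have [del del0 Hd] := H p Dp e e0.
by apply/nbhs_rVP; exists del => // q qp Dq; rewrite distrC; exact: Hd.
Qed.

(* Only the values on D matter, so the derivatives at the endpoints of the
   segment may be one-sided. *)
Lemma axis_MVT D i g dg p h : axis_convex D ->
  (forall q, D q -> is_pderiv D i g q (dg q)) ->
  D p -> D (p + h *: delta_mx 0 i) ->
  exists2 t : R, 0 <= t <= 1 &
    g (p + h *: delta_mx 0 i) - g p = h * dg (p + (t * h) *: delta_mx 0 i).
Proof.
move=> DC Hg Dp Dph.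
have [->|h0] := eqVneq h 0.
  by exists 0; rewrite ?lexx ?ler01 // scale0r addr0 subrr mul0r.
pose q (t : R) := p + (t * h) *: delta_mx 0 i : 'rV[R]_d.
have qD s t : q (s + t) = q s + (t * h) *: delta_mx 0 i.
  by rewrite /q mulrDl scalerDl addrA.
have Dq t : 0 <= t <= 1 -> D (q t) by move=> t01; exact: DC.
(* Both hypotheses of the mean value theorem on [[0, 1]], two-sided derivatives inside and
   continuity up to the endpoints, are read off from this estimate along the segment. *)
have slope t e : 0 <= t <= 1 -> 0 < e -> exists2 del : R, 0 < del &
    forall s, `|s| < del -> 0 <= t + s <= 1 ->
      `|g (q (t + s)) - g (q t) - s * (h * dg (q t))| <= e * `|s|.
  move=> t01 e0; have eh0 : 0 < e / `|h| by rewrite divr_gt0 ?normr_gt0.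
  have /is_pderivP/(_ _ eh0)[del del0 Hd] := Hg _ (Dq t t01).
  exists (del / `|h|) => [|s sd ts01]; first by rewrite divr_gt0 ?normr_gt0.
  have := Hd (s * h); rewrite -qD normrM -ltr_pdivlMr ?normr_gt0 //.
  move/(_ sd (Dq _ ts01)); rewrite mulrACA mulVf ?normr_eq0 // mulr1.
  by rewrite -mulrA.
have der (t : R) : t \in `]0, 1[ -> is_derive t 1 (g \o q) (h * dg (q t)).
  rewrite in_itv /= => /andP[t0 t1].
  suff cv : (r^-1 *: ((g \o q) (r *: 1 + t) - (g \o q) t)) @[r --> 0^'] --> h * dg (q t).
    by apply: DeriveDef; [apply/cvg_ex; exists (h * dg (q t))|exact: cvg_lim].
  apply/cvgrPdist_le => e e0.
  have [|del del0 Hd] := slope t e _ e0; first by rewrite !ltW.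
  apply/nbhs_ballP; exists (Num.min del (Num.min t (1 - t))) => /=.
    by rewrite !lt_min del0 t0 subr_gt0.
  move=> s; rewrite /ball /= sub0r normrN !lt_min => /and3P[sd st s1t] s0.
  have := Hd s sd; rewrite [_ *: 1]mulr1 (addrC s).
  have /ltr_normlP[? ?] := st; have /ltr_normlP[? ?] := s1t.
  move=> /(_ ltac:(lra)).
  by rewrite -quotient_dist_le.
have cont : {within `[0, 1], continuous (g \o q)}.
  apply/subspace_continuousP => t /=; rewrite in_itv /= => t01.
  apply/cvgrPdist_le => e e0; have [del del0 Hd] := slope t 1 t01 ltr01.
  set M := `|h * dg (q t)|; have M0 : 0 <= M by exact: normr_ge0.
  apply/nbhs_ballP; exists (Num.min del (e / (1 + M))) => /=.
    by rewrite lt_min del0 divr_gt0 // ltr_pwDl.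
  move=> s; rewrite /ball /= distrC lt_min => /andP[sd se].
  rewrite in_itv /= => s01.
  have := Hd (s - t) sd; rewrite addrC subrK => /(_ s01) H.
  rewrite distrC -(subrK ((s - t) * (h * dg (q t))) (_ - _)).
  apply: le_trans (ler_normD _ _) _; apply: le_trans (lerD H (lexx _)) _.
  rewrite normrM -/M [`|_| * M]mulrC -mulrDl mulrC -ler_pdivlMr ?ltr_pwDl //.
  exact: ltW.
have [t] := MVT ltr01 der cont.
rewrite in_itv /= => /andP[t0 t1]; rewrite subr0 mulr1 /= => E; exists t.
  by rewrite !ltW.
by rewrite -E /q mul1r mul0r scale0r addr0.
Qed.

End PartialDerivatives.

(** * Boxes and the chain rule *)

Section VectorPartialDerivatives.
Context {R : realType} {d n : nat}.
Implicit Types (D : set 'rV[R]_d) (g : 'rV[R]_d -> 'rV[R]_n) (p : 'rV[R]_d).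

Lemma pquotientP D i g p (v : 'rV[R]_n) : pquotient D i g p --> v <->
  forall j, is_pderiv D i (fun q => g q 0 j) p (v 0 j).
Proof.
rewrite /pquotient; split=> [/cvg_mxP H j|H].
  by have := H 0 j; under eq_fun do rewrite !mxE.
by apply/cvg_mxP => i' j; rewrite ord1; under eq_fun do rewrite !mxE; exact: H.
Qed.

Lemma pderivE D i g p (v : 'rV[R]_n) : axis_thick D -> D p ->
  (forall j, is_pderiv D i (fun q => g q 0 j) p (v 0 j)) ->
  pderiv D i g p = v.
Proof.
move=> DT Dp /pquotientP H; have PF := within_axis_proper i DT Dp.
exact: cvg_lim.
Qed.

Lemma Cr_is_pderiv r D g s i p j : Cr r D g -> (size s < r)%N -> D p ->
  is_pderiv D i (fun q => pderivs D s g q 0 j) p (pderivs D (i :: s) g p 0 j).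
Proof.
move=> /CrP[_ gd] sr Dp; have gp := gd s i p sr Dp.
exact: (pquotientP D i (pderivs D s g) p _).1.
Qed.

Lemma Cr_cont_on r D g s j : Cr r D g -> (size s <= r)%N ->
  cont_on D (fun q => pderivs D s g q 0 j).
Proof.
move=> /CrP[gc _] sr p Dp.
have /subspace_continuousP/(_ p Dp)/cvg_mxP := gc s sr; exact.
Qed.

Lemma Cr_intro r D g :
  (forall s j, (size s <= r)%N -> cont_on D (fun q => pderivs D s g q 0 j)) ->
  (forall s i p j, (size s < r)%N -> D p ->
    is_pderiv D i (fun q => pderivs D s g q 0 j) p (pderivs D (i :: s) g p 0 j)) ->
  Cr r D g.
Proof.
move=> gc gd; apply/CrP; split => [s sr|s i p sr Dp].
  apply/subspace_continuousP => p Dp; apply/cvg_mxP => i j; rewrite ord1.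
  exact: gc.
by apply/cvg_ex; exists (pderivs D (i :: s) g p); apply/pquotientP => j; exact: gd.
Qed.

End VectorPartialDerivatives.

Section Boxes.
Context {R : realType} {k n : nat}.

Definition cylinder (D : set 'rV[R]_k) : set 'rV[R]_(k + n) :=
  [set p | D (lsubmx p)].

Lemma cube_axis_convex : axis_convex (cube R k).
Proof.
move=> p i h t Dp Dph /andP[t0 t1] j; have := Dp j; have := Dph j.
rewrite !mxE eqxx /= !in_itv /= => /andP[] + + /andP[].
by case: (j == i) => /=; rewrite ?mulr1 ?mulr0 ?addr0 => *; apply/andP; split => //; nra.
Qed.

Lemma cube_axis_thick : axis_thick (cube R k).
Proof.
move=> p i e Dp e0.
pose m := Num.min (e / 2) 1.
have m0 : 0 < m by rewrite lt_min divr_gt0 //= ltr01.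
have m1 : m <= 1 by rewrite ge_min lexx orbT.
have me : m < e by rewrite gt_min; apply/orP; left; lra.
(* The step is directed towards the origin and has length at most 1, so it cannot leave
   [[-1, 1]]. *)
exists (if p 0 i <= 0 then m else - m); split.
- by case: ifP => _; rewrite ?oppr_eq0 gt_eqF.
- by case: ifP => _; rewrite ?normrN gtr0_norm.
move=> j; have := Dp j; rewrite !mxE eqxx /= !in_itv /= => /andP[].
have [->|ji] := eqVneq j i; last by rewrite mulr0 addr0 => *; apply/andP.
by case: ifPn; rewrite -?ltNge mulr1 => *; apply/andP; split; lra.
Qed.

Lemma row_mxDl (a : 'rV[R]_k) (x : 'rV[R]_n) h i :
  row_mx a x + h *: delta_mx 0 (lshift n i) = row_mx (a + h *: delta_mx 0 i) x.
Proof.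
apply/rowP => j; case: (split_ordP j) => j' ->; rewrite !mxE eqxx /=.
  by rewrite (unsplitK (inl j')) !mxE eqxx (inj_eq (@lshift_inj _ _)).
by rewrite (unsplitK (inr j')) eq_rlshift mulr0 addr0.
Qed.

Lemma row_mxDr (a : 'rV[R]_k) (x : 'rV[R]_n) h i :
  row_mx a x + h *: delta_mx 0 (rshift k i) = row_mx a (x + h *: delta_mx 0 i).
Proof.
apply/rowP => j; case: (split_ordP j) => j' ->; rewrite !mxE eqxx /=.
  by rewrite (unsplitK (inl j')) eq_lrshift mulr0 addr0.
by rewrite (unsplitK (inr j')) !mxE eqxx (inj_eq (@rshift_inj _ _)).
Qed.

Lemma cylinder_row_mx D (a : 'rV[R]_k) (x : 'rV[R]_n) : cylinder D (row_mx a x) = D a.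
Proof. by rewrite /cylinder /= row_mxKl. Qed.

Lemma cylinder_axis_convex D : axis_convex D -> axis_convex (cylinder D).
Proof.
move=> DC p i h t; rewrite -(hsubmxK p); case: (split_ordP i) => j ->.
  by rewrite !row_mxDl !cylinder_row_mx; exact: DC.
by rewrite !row_mxDr !cylinder_row_mx.
Qed.

Lemma cont_on_row_mx (D : set 'rV[R]_k) g a (x : 'rV[R]_n) : cont_on (cylinder D) g -> D a ->
  forall e : R, 0 < e -> exists2 del : R, 0 < del & forall a' (y : 'rV[R]_n), D a' ->
    (forall i, `|a' 0 i - a 0 i| < del) -> (forall j, `|y 0 j - x 0 j| < del) ->
    `|g (row_mx a' y) - g (row_mx a x)| <= e.
Proof.
move=> /cont_onP H Da e e0.
have [|del del0 Hd] := H (row_mx a x) _ e e0; first by rewrite cylinder_row_mx.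
exists del => // a' y Da' aa' xy; apply: Hd; first by rewrite cylinder_row_mx.
move=> j; case: (split_ordP j) => j' ->.
  by rewrite !row_mxEl.
by rewrite !row_mxEr.
Qed.

End Boxes.
Arguments cylinder {R k} n D.

Section ChainRule.
Context {R : realType} {k n : nat}.
Variables (D : set 'rV[R]_k) (g : 'rV[R]_(k + n) -> R)
  (gx : 'I_n -> 'rV[R]_(k + n) -> R).
Hypotheses (DC : axis_convex D)
  (Hg : forall q j, cylinder n D q -> is_pderiv (cylinder n D) (rshift k j) g q (gx j q))
  (Hc : forall j, cont_on (cylinder n D) (gx j)).

(** The point [y] is changed into [y'] one coordinate at a time. The mean value theorem applies to
    each change, and continuity of [gx] allows the intermediate point to be replaced by [(a, x)],
    uniformly in the nearby parameter [a']. *)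
Lemma strict_differentiability a (x : 'rV[R]_n) : D a -> forall e : R, 0 < e ->
  exists2 del : R, 0 < del & forall a' (y y' : 'rV[R]_n), D a' ->
    (forall i, `|a' 0 i - a 0 i| < del) ->
    (forall j, `|y 0 j - x 0 j| < del) -> (forall j, `|y' 0 j - x 0 j| < del) ->
    `|g (row_mx a' y') - g (row_mx a' y)
       - \sum_j (y' 0 j - y 0 j) * gx j (row_mx a x)|
      <= e * \sum_j `|y' 0 j - y 0 j|.
Proof.
move=> Da e e0.
have : forall j, exists del : R, 0 < del /\ forall a' (y : 'rV[R]_n), D a' ->
    (forall i, `|a' 0 i - a 0 i| < del) -> (forall j, `|y 0 j - x 0 j| < del) ->
    `|gx j (row_mx a' y) - gx j (row_mx a x)| <= e.
  by move=> j; have [del ? ?] := cont_on_row_mx x (@Hc j) Da e0; exists del.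
move=> /choice[delj Hdel].
pose del := \big[Num.min/1]_j delj j.
have del_le j : del <= delj j by exact: bigmin_le_cond.
exists del.
  by apply: lt_bigmin => // j _; have [] := Hdel j.
move=> a' y y' Da' aa' yx y'x.
(* [z m] has its first [m] coordinates taken from [y'], the others from [y]. *)
pose z (m : nat) : 'rV[R]_n := \row_j (if (j < m)%N then y' 0 j else y 0 j).
have zn : z n = y' by apply/rowP => j; rewrite mxE ltn_ord.
have z0 : z 0 = y by apply/rowP => j; rewrite mxE.
have zS (j : 'I_n) t : z j + (t * (y' 0 j - y 0 j)) *: delta_mx 0 j
    = \row_i (if i == j then y 0 j + t * (y' 0 j - y 0 j) else z j 0 i).
  apply/rowP => i; rewrite !mxE eqxx /=; have [->|ij] := eqVneq i j.
    by rewrite ltnn mulr1.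
  by rewrite mulr0 addr0.
have zS1 (j : 'I_n) : z j + (y' 0 j - y 0 j) *: delta_mx 0 j = z j.+1.
  rewrite -[_ - _]mul1r zS; apply/rowP => i; rewrite !mxE mul1r addrC subrK ltnS.
  by rewrite (leq_eqVlt i j) -val_eqE /=; case: eqP => //= /val_inj ->.
rewrite -{1}zn -{1}z0.
have -> : g (row_mx a' (z n)) - g (row_mx a' (z 0)) =
    \sum_(j < n) (g (row_mx a' (z j.+1)) - g (row_mx a' (z j))).
  rewrite -(big_mkord xpredT
    (fun j => g (row_mx a' (z j.+1)) - g (row_mx a' (z j)))).
  by rewrite telescope_sumr.
rewrite -sumrB mulr_sumr; apply: le_trans (ler_norm_sum _ _ _) _.
apply: ler_sum => j _.
have [||t t01] := @axis_MVT _ _ (cylinder n D) (rshift k j) g (gx j)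
    (row_mx a' (z j)) (y' 0 j - y 0 j) (cylinder_axis_convex DC) (fun q => @Hg q j).
- by rewrite cylinder_row_mx.
- by rewrite row_mxDr cylinder_row_mx.
rewrite !row_mxDr zS1 => ->; rewrite -mulrBr normrM mulrC ler_wpM2r //.
have [_ Hd] := Hdel j; apply: Hd => // i.
  exact: lt_le_trans (aa' i) (del_le j).
apply: lt_le_trans (del_le j); rewrite zS !mxE.
(* Each coordinate of the intermediate point lies between those of [y] and [y'], hence within [del]
   of that of [x]. *)
have := yx i; have := y'x i; have [->|ij] := eqVneq i j; last by case: ifP.
move=> /ltr_normlP[? ?] /ltr_normlP[? ?]; have /andP[t0 t1] := t01.
have : 0 <= t * (y' 0 j - y 0 j) <= y' 0 j - y 0 j \/
    y' 0 j - y 0 j <= t * (y' 0 j - y 0 j) <= 0.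
  by have [?|?] := leP (y 0 j) (y' 0 j); [left|right]; apply/andP; split; nra.
by case=> /andP[? ?]; apply/ltr_normlP; split; lra.
Qed.

(** The increment is split into a move of the parameter with [x a] frozen, governed by [l0], and a
    move in the fiber over the displaced parameter. The second move is why strict differentiability
    has to be uniform in the parameter; [T] is its error term. *)
Lemma chain_rule i (x : 'rV[R]_k -> 'rV[R]_n) a l0 (dx : 'I_n -> R) : D a ->
  is_pderiv (cylinder n D) (lshift n i) g (row_mx a (x a)) l0 ->
  (forall j, is_pderiv D i (fun q => x q 0 j) a (dx j)) ->
  is_pderiv D i (fun q => g (row_mx q (x q))) a
    (l0 + \sum_j dx j * gx j (row_mx a (x a))).
Proof.
move=> Da H0 Hx; set W := within [set h : R | D (a + h *: delta_mx 0 i)] 0^'.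
pose ah (h : R) := a + h *: delta_mx 0 i.
pose q j (h : R) := h^-1 * (x (ah h) 0 j - x a 0 j).
pose T h := g (row_mx (ah h) (x (ah h))) - g (row_mx (ah h) (x a))
  - \sum_j (x (ah h) 0 j - x a 0 j) * gx j (row_mx a (x a)).
have E h : h^-1 * (g (row_mx (ah h) (x (ah h))) - g (row_mx a (x a))) =
    (h^-1 * (g (row_mx (ah h) (x a)) - g (row_mx a (x a)))
      + \sum_j q j h * gx j (row_mx a (x a))) + h^-1 * T h.
  rewrite /q; under eq_bigr do rewrite -mulrA.
  by rewrite -mulr_sumr -!mulrDr; congr (_ * _); rewrite /T; ring.
rewrite /is_pderiv -/W; under eq_fun do rewrite E; rewrite -[l0 + _]addr0.
have W0 : Filter W by exact: within_filter.
apply: cvgD; first apply: cvgD.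
- move: H0; rewrite /is_pderiv; under eq_fun do rewrite row_mxDl.
  under eq_set do rewrite row_mxDl cylinder_row_mx.
  exact.
- by apply: cvg_sumR => j; apply: cvgM; [exact: Hx|exact: cvg_cst].
(* Boundedness of the difference quotients of [x] turns an error proportional to the increment of
   [x] into one proportional to [h]. *)
have qM : \forall h \near W, \sum_j `|q j h| <= \sum_j `|dx j| + 1.
  have : \sum_j `|q j h| @[h --> W] --> \sum_j `|dx j|.
    by apply: cvg_sumR => j; apply: cvg_norm; exact: Hx.
  move=> /cvgrPdist_le/(_ 1 ltr01); apply: filterS => h /ler_normlP[]; lra.
set M := \sum_j `|dx j| + 1 in qM.
have M0 : 0 < M by rewrite ltr_wpDl // sumr_ge0.
apply/cvgrPdist_le => e e0.
have [del del0 Hd] := strict_differentiability (x a) Da (divr_gt0 e0 M0).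
have xa : \forall h \near W, forall j, `|x (ah h) 0 j - x a 0 j| < del.
  apply: filter_forall => j; have /cvgrPdist_lt/(_ del del0) := is_pderiv_cvg (Hx j).
  by apply: filterS => h; rewrite distrC.
have aa : \forall h \near W, D (ah h) /\ forall j, `|ah h 0 j - a 0 j| < del.
  apply/nbhs_ballP; exists del => //= h; rewrite /ball /= sub0r normrN => hd _ Dh.
  split => // j; rewrite /ah !mxE eqxx /= addrAC subrr add0r.
  by case: (j == i); rewrite ?mulr1 // mulr0 normr0.
apply: filterS3 qM xa aa => h hM xh [Dh ahh].
rewrite sub0r normrN normrM.
apply: (@le_trans _ _ (`|h^-1| * (e / M * \sum_j `|x (ah h) 0 j - x a 0 j|))).
  by rewrite ler_wpM2l //; apply: Hd => // j; rewrite subrr normr0.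
rewrite mulrCA mulr_sumr; under eq_bigr do rewrite -normrM.
by rewrite mulrAC ler_pdivrMr // ler_pM2l.
Qed.

End ChainRule.

(** * Uniformly convergent affine recursions *)

Lemma near_and (T : Type) (F : set_system T) {FF : Filter F} (P Q : T -> Prop) :
  (\forall a \near F, P a) -> (\forall a \near F, Q a) ->
  \forall a \near F, P a /\ Q a.
Proof. exact: filterI. Qed.

Section LocallyUniformlyCauchy.
Context {R : realType} {T : Type}.
Variable (F : set_system T).
Context {FF : Filter F}.

(* All bounds are uniform in the auxiliary index [i] and in the point [a], locally
   along [F]; [ubc] stands for uniformly bounded and uniformly Cauchy. *)
Definition ubounded (I : Type) (u : I -> nat -> T -> R) : Prop :=
  exists M : R, \forall a \near F, forall i m, `|u i m a| <= M.

Definition ucauchy (I : Type) (u : I -> nat -> T -> R) : Prop :=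
  forall e : R, 0 < e -> exists N, \forall a \near F, forall i m p,
    (N <= m)%N -> `|u i (m + p)%N a - u i m a| <= e.

Definition ubc (I : Type) (u : I -> nat -> T -> R) : Prop :=
  ubounded u /\ ucauchy u.

Lemma ubounded_pos (I : Type) (u : I -> nat -> T -> R) : ubounded u ->
  exists2 M : R, 0 < M & \forall a \near F, forall i m, `|u i m a| <= M.
Proof.
move=> [M HM]; exists (Num.max M 1); first by rewrite lt_max ltr01 orbT.
by apply: filterS HM => a H i m; rewrite le_max H.
Qed.

Lemma ubc_cst (I : Type) (c : R) : ubc (fun (_ : I) _ _ => c).
Proof.
split; first by exists `|c|; apply: nearW.
by move=> e e0; exists 0%N; apply: nearW => a i m p _; rewrite subrr normr0 ltW.
Qed.

Lemma ubc_reindex (I I' : Type) (phi : I' -> I) u : ubc u ->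
  ubc (fun i => u (phi i)).
Proof.
move=> [[M HM] H]; split; first by exists M; apply: filterS HM => a Ha i; exact: Ha.
move=> e e0; have [N HN] := H e e0; exists N; apply: filterS HN => a Ha i.
exact: Ha.
Qed.

Lemma ubcD (I : Type) (u v : I -> nat -> T -> R) : ubc u -> ubc v ->
  ubc (fun i m a => u i m a + v i m a).
Proof.
move=> [[M HM] Hu] [[N HN] Hv]; split.
  exists (M + N); apply: filterS2 HM HN => a H1 H2 i m.
  by apply: le_trans (ler_normD _ _) _; exact: lerD.
move=> e e0; have e20 : 0 < e / 2 by rewrite divr_gt0.
have [N1 H1] := Hu _ e20; have [N2 H2] := Hv _ e20.
exists (maxn N1 N2); apply: filterS2 H1 H2 => a {}H1 {}H2 i m p.
rewrite geq_max => /andP[m1 m2].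
rewrite opprD addrACA [e]splitr; apply: le_trans (ler_normD _ _) _.
by apply: lerD; [exact: H1|exact: H2].
Qed.

Lemma ubcM (I : Type) (u v : I -> nat -> T -> R) : ubc u -> ubc v ->
  ubc (fun i m a => u i m a * v i m a).
Proof.
move=> [/ubounded_pos[M M0 HM] Hu] [/ubounded_pos[N N0 HN] Hv]; split.
  exists (M * N); apply: filterS2 HM HN => a H1 H2 i m.
  by rewrite normrM; exact: ler_pM.
move=> e e0; have e20 : 0 < e / 2 by rewrite divr_gt0.
have [N1 H1] := Hu _ (divr_gt0 e20 N0); have [N2 H2] := Hv _ (divr_gt0 e20 M0).
exists (maxn N1 N2).
apply: filterS2 (near_and HM HN) (near_and H1 H2).
move=> a [{}HM {}HN] [{}H1 {}H2] i m p.
rewrite geq_max => /andP[m1 m2].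
rewrite (_ : _ - _ = (u i (m + p)%N a - u i m a) * v i (m + p)%N a +
   u i m a * (v i (m + p)%N a - v i m a)); last by ring.
rewrite [e]splitr; apply: le_trans (ler_normD _ _) _; rewrite !normrM; apply: lerD.
  by rewrite -[leRHS](divfK (lt0r_neq0 N0)); apply: ler_pM => //; exact: H1.
by rewrite mulrC -[leRHS](divfK (lt0r_neq0 M0)); apply: ler_pM => //; exact: H2.
Qed.

End LocallyUniformlyCauchy.

Section LinearRecursion.
Context {R : realType} {T : Type} {n : nat}.
Variable (F : set_system T).
Context {FF : Filter F}.
Variables (I : Type) (sigma : I -> I).
Variables (v : I -> nat -> T -> 'rV[R]_n) (L : I -> nat -> T -> 'M[R]_n) (c : R).
(** The inhomogeneous term of the recursion. In the application [i] is a sequence of symbols and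
    [sigma] the shift. *)
Let w i m a := v i m.+1 a - v (sigma i) m a *m L i m a.
Hypotheses (c0 : 0 <= c) (c1 : c < 1)
  (v0 : \forall a \near F, forall i, v i 0%N a = 0)
  (Lc : \forall a \near F, forall i m z, enorm (z *m L i m a) <= c * enorm z)
  (Lubc : forall j l, ubc F (fun i m a => L i m a j l))
  (wubc : forall l, ubc F (fun i m a => w i m a 0 l)).

Lemma enorm_bounded (u : I -> nat -> T -> 'rV[R]_n) :
  (forall l, ubounded F (fun i m a => u i m a 0 l)) ->
  exists2 M : R, 0 < M & \forall a \near F, forall i m, enorm (u i m a) <= M.
Proof.
move=> H; have /choice[M HM] : forall l, exists M : R, 0 < M /\
    \forall a \near F, forall i m, `|u i m a 0 l| <= M.
  by move=> l; have [M ? ?] := ubounded_pos (H l); exists M.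
exists (\sum_l M l + 1).
  by rewrite ltr_wpDl // sumr_ge0 // => l _; rewrite ltW //; have [] := HM l.
have : \forall a \near F, forall l i m, `|u i m a 0 l| <= M l.
  by apply: filter_forall => l; have [] := HM l.
apply: filterS => a Ha i m; apply: le_trans (enorm_le_sum _) _.
by rewrite ler_wpDr // ler_sum.
Qed.

Lemma enorm_cauchy (u : I -> nat -> T -> 'rV[R]_n) :
  (forall l, ucauchy F (fun i m a => u i m a 0 l)) ->
  forall e : R, 0 < e -> exists N, \forall a \near F, forall i m p, (N <= m)%N ->
    enorm (u i (m + p)%N a - u i m a) <= e.
Proof.
move=> H e e0; have e'0 : 0 < e / n.+1%:R by rewrite divr_gt0.
have /choice[N HN] : forall l, exists N, \forall a \near F, forall i m p, (N <= m)%N ->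
    `|u i (m + p)%N a 0 l - u i m a 0 l| <= e / n.+1%:R.
  by move=> l; exact: H.
exists (\max_l N l).
have {HN} : \forall a \near F, forall l i m p, (N l <= m)%N ->
    `|u i (m + p)%N a 0 l - u i m a 0 l| <= e / n.+1%:R.
  by apply: filter_forall => l; exact: HN.
apply: filterS => a Ha i m p Nm; apply: le_trans (enorm_le_sum _) _.
apply: (@le_trans _ _ (\sum_(l < n) e / n.+1%:R)).
  apply: ler_sum => l _; rewrite !mxE; apply: Ha.
  exact: leq_trans (leq_bigmax _) Nm.
rewrite sumr_const card_ord -[_ *+ n]mulr_natl mulrCA ger_pMr // ler_pdivrMr // mul1r.
by rewrite ler_nat.
Qed.

Lemma recursion_bounded :
  exists2 M : R, 0 < M & \forall a \near F, forall i m, enorm (v i m a) <= M.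
Proof.
have [M M0 HM] := enorm_bounded (fun l => (wubc l).1).
(* The fixed point of [t |-> c * t + M]: the ball of this radius contains the initial value 0 and is
   preserved by the recursion. *)
exists (M / (1 - c)); first by rewrite divr_gt0 // subr_gt0.
apply: filterS3 HM v0 Lc => a {}HM v0a Lca i m.
elim: m i => [|m IH] i.
  by rewrite v0a enorm0 ltW // divr_gt0 // subr_gt0.
have -> : v i m.+1 a = v (sigma i) m a *m L i m a + w i m a.
  by rewrite /w addrC subrK.
apply: le_trans (ler_enormD _ _) _.
apply: (@le_trans _ _ (c * (M / (1 - c)) + M)).
  by apply: lerD => //; apply: le_trans (Lca _ _ _) _; rewrite ler_wpM2l.
have h : 1 - c != 0 by rewrite gt_eqF // subr_gt0.
by rewrite le_eqVlt; apply/orP; left; apply/eqP; field.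
Qed.

Let tail_le E := exists N, \forall a \near F, forall i m p, (N <= m)%N ->
  enorm (v i (m + p)%N a - v i m a) <= E.

(** One step of the recursion shrinks the eventual oscillation by the factor [c], up to an
    arbitrarily small error. In the splitting of the difference, the first term is at most [c * E];
    the other two are small because [v] is bounded while [L] and [w] are uniformly Cauchy. *)
Lemma tail_le_step E e : 0 < e -> tail_le E -> tail_le (c * E + e).
Proof.
move=> e0 [N HN]; have [V V0 HV] := recursion_bounded.
have e20 : 0 < e / 2 by rewrite divr_gt0.
have [N1 HN1] := enorm_cauchy (fun l => (wubc l).2) e20.
(* Here [n%:R * V] bounds the sum of the moduli of the coordinates of [v], and [n.+1] shares the
   error among the output coordinates. The added units keep the denominators positive. *)
pose e' := e / 2 / (n%:R * V + 1) / n.+1%:R.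
have e'0 : 0 < e'.
  by rewrite !divr_gt0 // ltr_wpDl // mulr_ge0 // ltW.
have /choice[N2 HN2] : forall jl : 'I_n * 'I_n, exists N, \forall a \near F,
    forall i m p, (N <= m)%N -> `|L i (m + p)%N a jl.1 jl.2 - L i m a jl.1 jl.2| <= e'.
  by move=> [j l]; exact: (Lubc j l).2.
have {}HN2 : \forall a \near F, forall jl i m p, (N2 jl <= m)%N ->
    `|L i (m + p)%N a jl.1 jl.2 - L i m a jl.1 jl.2| <= e'.
  by apply: filter_forall => jl; exact: HN2.
(* The successor is there because the value at [m.+1] is estimated by the data at [m]. *)
exists (maxn N (maxn N1 (\max_jl N2 jl))).+1.
apply: filterS3 (near_and HN HV) (near_and Lc HN1) HN2.
move=> a [{}HN {}HV] [Lca {}HN1] {}HN2 i [//|m] p.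
rewrite ltnS !geq_max => /and3P[mN mN1 mN2].
rewrite addSn.
have vS m' : v i m'.+1 a = v (sigma i) m' a *m L i m' a + w i m' a.
  by rewrite /w addrC subrK.
rewrite !vS.
have -> : forall (x x' : 'rV[R]_n) (A A' : 'M[R]_n) (y y' : 'rV[R]_n),
    x' *m A' + y' - (x *m A + y) = (x' - x) *m A' + (x *m (A' - A) + (y' - y)).
  move=> x x' A A' y y'.
  by rewrite mulmxBl mulmxBr [RHS]addrA subrKA opprD addrACA.
apply: le_trans (ler_enormD _ _) _; apply: lerD.
  by apply: le_trans (Lca _ _ _) _; rewrite ler_wpM2l // HN.
rewrite [e]splitr; apply: le_trans (ler_enormD _ _) _; apply: lerD; last exact: HN1.
apply: le_trans (enorm_le_sum _) _.
apply: (@le_trans _ _ (\sum_(l < n) e / 2 / n.+1%:R)).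
  apply: ler_sum => l _; rewrite mxE; apply: le_trans (ler_norm_sum _ _ _) _.
  apply: (@le_trans _ _ (\sum_j `|v (sigma i) m a 0 j| * e')).
    apply: ler_sum => j _; rewrite normrM ler_wpM2l // !mxE.
    apply: (HN2 (j, l)); exact: leq_trans (leq_bigmax _) mN2.
  rewrite -mulr_suml /e' 2!mulrA ler_wpM2r ?invr_ge0 //.
  rewrite [_ * (e / 2)]mulrC -mulrA.
  rewrite ler_piMr ?(ltW e20) // ler_pdivrMr.
    rewrite mul1r; apply: le_trans (sum_le_enorm _) _.
    by rewrite ler_wpDr // ler_wpM2l.
  by rewrite ltr_wpDl // mulr_ge0 // ltW.
rewrite sumr_const card_ord -[_ *+ n]mulr_natl mulrCA ger_pMr // ler_pdivrMr // mul1r.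
by rewrite ler_nat.
Qed.

Lemma recursion_ubc l : ubc F (fun i m a => v i m a 0 l).
Proof.
have [V V0 HV] := recursion_bounded; split.
  exists V; apply: filterS HV => a Ha i m.
  exact: le_trans (coord_le_enorm _ _) (Ha _ _).
move=> e e0; have e20 : 0 < e / 2 by rewrite divr_gt0.
have step j : tail_le (c ^+ j * (2 * V) + e / 2).
  elim: j => [|j IH].
    exists 0%N; apply: filterS HV => a Ha i m p _; rewrite expr0 mul1r.
    apply: ler_wpDr; first exact: ltW.
    by apply: le_trans (ler_enormB _ _) _; rewrite mulr2n mulrDl mul1r lerD.
  (* With this error [e / 2] is the fixed point of [t |-> c * t + (1 - c) * (e / 2)], so only the
     part [c ^+ j * (2 * V)] changes with [j]. *)
  have e3 : 0 < (1 - c) * (e / 2) by rewrite mulr_gt0 // subr_gt0.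
  have := tail_le_step e3 IH; congr tail_le; rewrite exprS; ring.
have : (fun j => c ^+ j * (2 * V)) @ \oo --> 0 * (2 * V).
  by apply: cvgM; [apply: cvg_expr; rewrite ger0_norm|exact: cvg_cst].
rewrite mul0r => /cvgrPdist_le/(_ _ e20)[j _ /(_ j (leqnn _))] /=.
rewrite sub0r normrN => /(le_trans (ler_norm _)) Hj.
have [N HN] := step j; exists N; apply: filterS HN => a Ha i m p Nm.
have := coord_le_enorm (v i (m + p)%N a - v i m a) l; rewrite !mxE => /le_trans; apply.
by apply: le_trans (Ha _ _ _ Nm) _; rewrite [leRHS]splitr lerD2r.
Qed.

End LinearRecursion.

(** * Compactness in the fiber *)

Section Tube.
Context {R : realType} {k n : nat}.
Variables (D : set 'rV[R]_k) (a0 : 'rV[R]_k).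

(* The parameter s, tending to infinity, carries the constants that compactness
   makes uniform. *)
Lemma compact_tube (X : topologicalType) (K : set X) (P : R -> 'rV[R]_k -> X -> Prop) :
  compact K ->
  (forall x, K x -> exists U (s0 del : R), [/\ nbhs x U, 0 < del &
    forall s a y, s0 <= s -> D a -> (forall i, `|a 0 i - a0 0 i| < del) -> U y ->
      P s a y]) ->
  exists2 s : R, 0 < s & \forall a \near within D (nbhs a0), forall x, K x -> P s a x.
Proof.
move=> /compact_near_coveringP Kc H.
have := Kc _ (filter_prod (within D (nbhs a0)) (@pinfty_nbhs R))
  (fun q x => P q.2 q.1 x) _.
case=> [x Kx|[A S] /= [FA [M [_ SM]]] AS].
  have [U [s0 [del [xU del0 HU]]]] := H x Kx.
  exists (U, [set q | (D q.1 /\ forall i, `|q.1 0 i - a0 0 i| < del) /\ s0 <= q.2]) => /=.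
    split => //.
    exists ([set a | D a /\ forall i, `|a 0 i - a0 0 i| < del], [set s | s0 <= s]) => /=.
      split; last by exists s0; split => [|s /ltW]; rewrite ?num_real.
      by apply/nbhs_rVP; exists del.
    by move=> [a s] /= [].
  by move=> [y [a s]] /= [Uy [[Da aa] ss]]; exact: HU.
exists (Num.max 1 (M + 1)); first by rewrite lt_max ltr01.
apply: filterS FA => a Aa; apply: (AS (a, _)); split => //=.
by apply: SM; rewrite lt_max ltrDl ltr01 orbT.
Qed.

(** A continuous [g c] carries no modulus of its own, which is the situation of the derivatives of
    top order. Compactness of [K] provides a bound and a modulus of continuity valid for all
    parameters near [a0], and finiteness of [B] makes them common to all [c]. *)
Lemma ubc_comp (B : finType) (I : Type) (phi : I -> B) (K : set 'rV[R]_n)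
    (g : B -> 'rV[R]_(k + n) -> R) (x : I -> nat -> 'rV[R]_k -> 'rV[R]_n) :
  D a0 -> compact K -> (forall c, cont_on (cylinder n D) (g c)) ->
  (\forall a \near within D (nbhs a0), forall i m, K (x i m a)) ->
  (forall j, ubc (within D (nbhs a0)) (fun i m a => x i m a 0 j)) ->
  ubc (within D (nbhs a0)) (fun i m a => g (phi i) (row_mx a (x i m a))).
Proof.
move=> Da0 Kc gc xK xc; have aD : \forall a \near within D (nbhs a0), D a.
  exact: withinT.
split.
  have : forall c, exists M : R, \forall a \near within D (nbhs a0), forall y, K y ->
      `|g c (row_mx a y)| <= M.
    move=> c; have [|M M0 HM] := @compact_tube _ K (fun M a y => `|g c (row_mx a y)| <= M) Kc.
      move=> y Ky; have [del del0 Hd] := cont_on_row_mx y (@gc c) Da0 ltr01.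
      exists [set y' : 'rV[R]_n | forall j, `|y' 0 j - y 0 j| < del],
        (`|g c (row_mx a0 y)| + 1), del.
      split => //; first by apply/nbhs_rVP; exists del.
      move=> s a y' ss Da aa yy; apply: le_trans ss.
      rewrite -lerBlDl; apply: le_trans (lerB_dist _ _) _; exact: Hd.
    by exists M.
  move=> /choice[M HM]; exists (\sum_c `|M c|).
  have {}HM : \forall a \near within D (nbhs a0), forall c y, K y ->
      `|g c (row_mx a y)| <= M c by apply: filter_forall => c; exact: HM.
  apply: filterS2 HM xK => a Ha xa i m; apply: le_trans (Ha _ _ (xa i m)) _.
  by rewrite (bigD1 (phi i)) //= ler_wpDr ?sumr_ge0 // ler_norm.
move=> e e0.
(* The modulus of continuity is written [s^-1], so that it shrinks as the parameter [s] of
   [compact_tube] grows. *)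
have : forall c, exists s : R, 0 < s /\ \forall a \near within D (nbhs a0), forall y, K y ->
    forall y' : 'rV[R]_n, (forall j, `|y' 0 j - y 0 j| < s^-1) ->
    `|g c (row_mx a y') - g c (row_mx a y)| <= e.
  move=> c.
  have [|s s0 Hs] := @compact_tube _ K (fun s a y =>
    forall y' : 'rV[R]_n, (forall j, `|y' 0 j - y 0 j| < s^-1) ->
      `|g c (row_mx a y') - g c (row_mx a y)| <= e) Kc; last by exists s.
  move=> y Ky; have [|del del0 Hd] := cont_on_row_mx y (@gc c) Da0 (_ : 0 < e / 2).
    by rewrite divr_gt0.
  have d20 : 0 < del / 2 by rewrite divr_gt0.
  exists [set y' : 'rV[R]_n | forall j, `|y' 0 j - y 0 j| < del / 2], (del / 2)^-1, del.
  split => //; first by apply/nbhs_rVP; exists (del / 2).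
  move=> s a y1 ss Da aa y1y y2 y2y.
  have s0 : 0 < s by apply: lt_le_trans ss; rewrite invr_gt0.
  have sd : s^-1 <= del / 2 by rewrite -[leRHS]invrK lef_pV2 ?posrE // invr_gt0.
  rewrite -(subrKA (g c (row_mx a0 y))) [e]splitr.
  apply: le_trans (ler_normD _ _) _; apply: lerD.
    apply: Hd => // j; rewrite -(subrKA (y1 0 j)) (splitr del).
    apply: le_lt_trans (ler_normD _ _) _; apply: ltrD; last exact: y1y.
    exact: lt_le_trans (y2y j) sd.
  rewrite distrC; apply: Hd => // j; apply: lt_trans (y1y j) _.
  by rewrite ltr_pdivrMr // ltr_pMr // ltr1n.
move=> /choice[s Hs].
have s0 c : 0 < s c by have [] := Hs c.
have {}Hs : \forall a \near within D (nbhs a0), forall c y, K y ->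
    forall y' : 'rV[R]_n, (forall j, `|y' 0 j - y 0 j| < (s c)^-1) ->
    `|g c (row_mx a y') - g c (row_mx a y)| <= e.
  by apply: filter_forall => c; have [] := Hs c.
(* [S] exceeds every [s c], so [S^-1] serves all the maps simultaneously. *)
pose S := \sum_c s c + 1.
have S0 : 0 < S by rewrite ltr_wpDl // sumr_ge0 // => c _; exact: ltW.
have sS c : S^-1 < (s c)^-1.
  rewrite ltf_pV2 ?posrE // ltr_pwDr // (bigD1 c) //= lerDl sumr_ge0 // => i _.
  exact: ltW.
have [|N HN] := enorm_cauchy (fun j => (xc j).2) (_ : 0 < S^-1).
  by rewrite invr_gt0.
exists N; apply: filterS3 Hs xK HN => a {}Hs xa {}HN i m p Nm.
apply: Hs => // j; apply: le_lt_trans (sS _).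
have := coord_le_enorm (x i (m + p)%N a - x i m a) j; rewrite !mxE => /le_trans.
by apply; exact: HN.
Qed.

End Tube.

(** * Local uniform contraction *)

Section LocalContraction.
Context {R : realType} {k n : nat} {B : finType}.
Variables (r : nat) (f : B -> 'rV[R]_k -> 'rV[R]_n -> 'rV[R]_n).
Hypotheses (r_gt0 : (0 < r)%N) (f_IFS : parametrized_IFS r f).

Let D := cylinder n (cube R k).

Definition total_map (c : B) (p : 'rV[R]_(k + n)) : 'rV[R]_n :=
  f c (lsubmx p) (rsubmx p).

(* With the row-vector convention, [v *m fiber_jacobian c (row_mx a x)] is the
   derivative of [f c a] at [x] in the direction [v]. *)
Definition fiber_jacobian (c : B) (q : 'rV[R]_(k + n)) : 'M[R]_n :=
  \matrix_(j, l) pderivs D [:: rshift k j] (total_map c) q 0 l.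

Lemma total_map_row_mx c a x : total_map c (row_mx a x) = f c a x.
Proof. by rewrite /total_map row_mxKl row_mxKr. Qed.

Lemma total_map_Cr c : Cr r D (total_map c).
Proof. exact: f_IFS.1. Qed.

Lemma fin_pos_choice (J : finType) (P : J -> R -> Prop) :
  (forall j d d', d' <= d -> P j d -> P j d') ->
  (forall j, exists2 d : R, 0 < d & P j d) ->
  exists2 d : R, 0 < d & forall j, P j d.
Proof.
move=> Pd H; have /choice[d Hd] : forall j, exists d : R, 0 < d /\ P j d.
  by move=> j; have [d ? ?] := H j; exists d.
exists (\big[Num.min/1]_j d j).
  by apply: lt_bigmin => // j _; have [] := Hd j.
by move=> j; have [_] := Hd j; apply: Pd; exact: bigmin_le_cond.
Qed.

Lemma enorm_le_coord (x : 'rV[R]_n) (d : R) : (forall j, `|x 0 j| <= d) ->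
  enorm x <= n%:R * d.
Proof.
move=> H; apply: le_trans (enorm_le_sum _) _.
apply: (@le_trans _ _ (\sum_(j < n) d)); first by apply: ler_sum => j _; exact: H.
by rewrite sumr_const card_ord mulr_natl.
Qed.

(** Used to share an error among [m] coordinates; dividing by [m.+1] makes sense for [m = 0] too. *)
Lemma natM_div_succ_le (m : nat) (e : R) : 0 <= e -> m%:R * (e / m.+1%:R) <= e.
Proof.
move=> e0; rewrite mulrCA ler_piMr // ler_pdivrMr // mul1r ler_nat.
exact: leqnSn.
Qed.

Lemma fiber_cont c a (x : 'rV[R]_n) : cube R k a -> forall e : R, 0 < e ->
  exists2 del : R, 0 < del & forall a' (y : 'rV[R]_n), cube R k a' ->
    (forall i, `|a' 0 i - a 0 i| < del) -> (forall j, `|y 0 j - x 0 j| < del) ->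
    enorm (f c a' y - f c a x) <= e.
Proof.
move=> Da e e0.
have [||del del0 Hd] := @fin_pos_choice 'I_n (fun l del =>
  forall a' (y : 'rV[R]_n), cube R k a' ->
    (forall i, `|a' 0 i - a 0 i| < del) -> (forall j, `|y 0 j - x 0 j| < del) ->
    `|f c a' y 0 l - f c a x 0 l| <= e / n.+1%:R).
- move=> l d d' dd H a' y Da' aa yx.
  by apply: H => // i; [exact: lt_le_trans (aa i) dd|exact: lt_le_trans (yx i) dd].
- move=> l; have e'0 : 0 < e / n.+1%:R by rewrite divr_gt0.
  have C := @Cr_cont_on _ _ _ r D (total_map c) [::] l (total_map_Cr c) (leq0n _).
  have [del del0 Hd] := cont_on_row_mx x C Da e'0; exists del => // a' y Da' aa yx.
  by have := Hd a' y Da' aa yx; rewrite /= !total_map_row_mx.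
exists del => // a' y Da' aa yx; apply: le_trans (natM_div_succ_le n (ltW e0)).
by apply: enorm_le_coord => l; rewrite !mxE; exact: Hd.
Qed.

Lemma fiber_strict_differentiability c a (x : 'rV[R]_n) : cube R k a ->
  forall e : R, 0 < e ->
  exists2 del : R, 0 < del & forall a' (y y' : 'rV[R]_n), cube R k a' ->
    (forall i, `|a' 0 i - a 0 i| < del) ->
    (forall j, `|y 0 j - x 0 j| < del) -> (forall j, `|y' 0 j - x 0 j| < del) ->
    enorm (f c a' y' - f c a' y - (y' - y) *m fiber_jacobian c (row_mx a x))
      <= e * enorm (y' - y).
Proof.
(* One division pays for comparing the sum of the moduli with the Euclidean norm, the other for
   summing over the output coordinates. *)
move=> Da e e0; pose e' := e / n.+1%:R / n.+1%:R.
have e'0 : 0 < e' by rewrite !divr_gt0.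
have [||del del0 Hd] := @fin_pos_choice 'I_n (fun l del =>
  forall a' (y y' : 'rV[R]_n), cube R k a' ->
    (forall i, `|a' 0 i - a 0 i| < del) ->
    (forall j, `|y 0 j - x 0 j| < del) -> (forall j, `|y' 0 j - x 0 j| < del) ->
    `|f c a' y' 0 l - f c a' y 0 l
       - \sum_j (y' 0 j - y 0 j) * fiber_jacobian c (row_mx a x) j l|
      <= e' * \sum_j `|y' 0 j - y 0 j|).
- move=> l d d' dd H a' y y' Da' aa yx yx'.
  by apply: H => // i; [exact: lt_le_trans (aa i) dd|exact: lt_le_trans (yx i) dd|
    exact: lt_le_trans (yx' i) dd].
- move=> l.
  have [del del0 Hd] := @strict_differentiability _ k n (cube R k)
    (fun q => total_map c q 0 l)
    (fun j q => pderivs D [:: rshift k j] (total_map c) q 0 l) cube_axis_convex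
    (fun q j Dq => @Cr_is_pderiv _ _ _ _ _ _ [::] (rshift k j) q l (total_map_Cr c) r_gt0 Dq)
    (fun j => @Cr_cont_on _ _ _ _ _ _ [:: rshift k j] l (total_map_Cr c) r_gt0)
    a x Da e' e'0.
  exists del => // a' y y' Da' aa yx yx'; have := Hd a' y y' Da' aa yx yx'.
  rewrite !total_map_row_mx; congr (`|_ - _| <= _).
  by apply: eq_bigr => j _; rewrite mxE.
exists del => // a' y y' Da' aa yx yx'.
apply: le_trans (enorm_le_coord (d := e / n.+1%:R * enorm (y' - y)) _) _.
  move=> l; rewrite !mxE; under eq_bigr do rewrite 2!mxE.
  apply: le_trans (Hd l _ _ _ Da' aa yx yx') _.
  have := sum_le_enorm (y' - y); under eq_bigr do rewrite 2!mxE.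
  rewrite -(ler_pM2l e'0) => /le_trans; apply.
  rewrite mulrA ler_wpM2r ?enorm_ge0 // mulrC natM_div_succ_le // divr_ge0 //.
  exact: ltW.
rewrite mulrA ler_wpM2r ?enorm_ge0 // natM_div_succ_le //; exact: ltW.
Qed.

(** The increment of [f c a] from [x] to [x + t *: v], divided by [t], is at most [C * enorm v] and
    differs from the image of [v] under the derivative by an arbitrarily small error. *)
Lemma fiber_jacobian_norm c a (x : 'rV[R]_n) (C : R) : cube R k a ->
  (exists2 del : R, 0 < del & forall y : 'rV[R]_n, (forall j, `|y 0 j - x 0 j| < del) ->
    enorm (f c a y - f c a x) <= C * enorm (y - x)) ->
  forall v, enorm (v *m fiber_jacobian c (row_mx a x)) <= C * enorm v.
Proof.
move=> Da [d1 d10 H1] v; apply/ler_addgt0Pr => e e0.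
have v10 : 0 < enorm v + 1 by rewrite ltr_wpDl ?enorm_ge0.
have [d2 d20 H2] := fiber_strict_differentiability c x Da (divr_gt0 e0 v10).
pose d := Num.min d1 d2; have d0 : 0 < d by rewrite lt_min d10.
(* The added 1 covers [v = 0] and gives the strict inequality [t * enorm v < d]. *)
pose t := d / (enorm v + 1); have t0 : 0 < t by rewrite divr_gt0.
have tv : t * enorm v < d.
  by rewrite /t mulrAC ltr_pdivrMr // ltr_pM2l // ltrDl.
pose y := x + t *: v.
have yx : y - x = t *: v by rewrite /y addrC addKr.
have yd j : `|y 0 j - x 0 j| < d.
  have -> : y 0 j - x 0 j = (y - x) 0 j by rewrite !mxE.
  by apply: le_lt_trans (coord_le_enorm _ _) _; rewrite yx enormZ gtr0_norm.
have A1 : enorm (f c a y - f c a x) <= C * enorm (y - x).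
  by apply: H1 => j; apply: lt_le_trans (yd j) _; rewrite ge_min lexx.
have A2 : enorm (f c a y - f c a x - (y - x) *m fiber_jacobian c (row_mx a x))
    <= e / (enorm v + 1) * enorm (y - x).
  apply: H2 => // j; rewrite ?subrr ?normr0 //.
  by apply: lt_le_trans (yd j) _; rewrite ge_min lexx orbT.
rewrite -(ler_pM2l t0) -{1}(gtr0_norm t0) -enormZ scalemxAl -yx.
rewrite -(subKr (f c a y - f c a x) ((y - x) *m _)).
apply: le_trans (ler_enormB _ _) _; apply: le_trans (lerD A1 A2) _.
rewrite yx enormZ gtr0_norm // mulrDr mulrCA lerD2l mulrCA ler_pM2l //.
by rewrite mulrAC ler_pdivrMr // ler_pM2l // lerDl.
Qed.

Lemma contraction_constant a : cube R k a -> exists2 c : R, 0 <= c < 1 &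
  forall b x y, enorm (f b a x - f b a y) <= c * enorm (x - y).
Proof.
move=> Da.
have /choice[c Hc] : forall b, exists c : R, c < 1 /\
    forall x y, enorm (f b a x - f b a y) <= c * enorm (x - y).
  by move=> b; have [c ? ?] := f_IFS.2 b a Da; exists c.
(* The base value 0 ensures nonnegativity, which [contracting] does not impose on its constant. *)
exists (\big[Num.max/0]_b c b).
  apply/andP; split; first exact: bigmax_ge_id.
  by apply: bigmax_lt => // b _; have [] := Hc b.
move=> b x y; have [_ H] := Hc b; apply: le_trans (H x y) _.
by rewrite ler_wpM2r ?enorm_ge0 // le_bigmax_cond.
Qed.

(** The contraction hypothesis is exploited at [a0] only. It extends to nearby parameters by
    compactness of the ball and of its square: continuity handles pairs of distinct points, strict
    differentiability those on the diagonal. *)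
Lemma local_contraction a0 : cube R k a0 -> exists rho c : R,
  [/\ 0 < rho, 0 <= c < 1 & \forall a \near within (cube R k) (nbhs a0), forall b,
    (forall x, enorm x <= rho -> enorm (f b a x) < rho) /\
    (forall x y, enorm x <= rho -> enorm y <= rho ->
      enorm (f b a x - f b a y) <= c * enorm (x - y))].
Proof.
move=> Da0; have [c0 /andP[c00 c01] Hc] := contraction_constant Da0.
pose M := \sum_b enorm (f b a0 0).
have M0 : 0 <= M by apply: sumr_ge0 => b _; exact: enorm_ge0.
(* With this radius [c0 * rho + M = rho - (1 - c0)], so the ball is sent strictly inside itself.
   Taking [c] halfway between [c0] and 1 leaves the slack [c - c0] for changing the parameter. *)
pose rho := M / (1 - c0) + 1; pose c := (1 + c0) / 2.
have cc0 : c0 < c by rewrite /c; lra.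
have c1 : c < 1 by rewrite /c; lra.
have c_ge0 : 0 <= c by rewrite /c; lra.
have rho0 : 0 < rho by rewrite ltr_wpDl // divr_ge0 // subr_ge0 ltW.
have f_rho b x : enorm x <= rho -> enorm (f b a0 x) < rho.
  move=> xr; rewrite -[f b a0 x](subrK (f b a0 0)).
  apply: le_lt_trans (ler_enormD _ _) _.
  apply: (@le_lt_trans _ _ (c0 * rho + M)).
    apply: lerD; first by apply: le_trans (Hc _ _ _) _; rewrite subr0 ler_wpM2l.
    by rewrite /M (bigD1 b) //= lerDl sumr_ge0 // => i _; exact: enorm_ge0.
  have -> : c0 * rho + M = rho - (1 - c0).
    have h : 1 - c0 != 0 by rewrite gt_eqF // subr_gt0.
    by rewrite /rho; field.
  by rewrite ltrBlDr ltrDl subr_gt0.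
exists rho, c; split => //; first by rewrite c_ge0.
have ball_cpt := @compact_eball R n rho.
apply: filter_forall => b; apply: near_and.
  have [|s _ Hs] := @compact_tube _ k (cube R k) a0 _ _
    (fun _ a x => enorm (f b a x) < rho) ball_cpt; last exact: Hs.
  move=> x xr; pose g := rho - enorm (f b a0 x).
  have g20 : 0 < g / 2 by rewrite divr_gt0 // subr_gt0 f_rho.
  have [del del0 Hd] := fiber_cont b x Da0 g20.
  exists [set y : 'rV[R]_n | forall j, `|y 0 j - x 0 j| < del], 0, del.
  split => //; first by apply/nbhs_rVP; exists del.
  move=> s a y _ Da aa yx; rewrite -[f b a y](subrK (f b a0 x)).
  apply: le_lt_trans (ler_enormD _ _) _.
  apply: le_lt_trans (lerD (Hd a y Da aa yx) (lexx _)) _.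
  by move: g20; rewrite /g; lra.
have [|s _ Hs] := @compact_tube _ k (cube R k) a0 _ _
    (fun _ a (xy : 'rV[R]_n * 'rV[R]_n) =>
      enorm (f b a xy.1 - f b a xy.2) <= c * enorm (xy.1 - xy.2))
    (compact_setX ball_cpt ball_cpt).
  move=> [x y] _ /=; have [<-{y}|xy] := eqVneq x y.
    (* On the diagonal both sides of the inequality vanish and continuity gives nothing; the
       derivative at [x], bounded by [c0], takes over. *)
    have [|del del0 Hd] := fiber_strict_differentiability b x Da0 (_ : 0 < c - c0).
      by rewrite subr_gt0.
    pose U := [set y : 'rV[R]_n | forall j, `|y 0 j - x 0 j| < del].
    exists (U `*` U), 0, del; split => //.
      by exists (U, U) => //=; split; apply/nbhs_rVP; exists del.
    move=> s a [y y'] _ Da aa [/= Uy Uy'].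
    rewrite -[f b a y - _](subrK ((y - y') *m fiber_jacobian b (row_mx a0 x))).
    apply: le_trans (ler_enormD _ _) _.
    apply: le_trans (lerD (Hd a y' y Da aa Uy' Uy) _) _.
      apply: fiber_jacobian_norm => //; exists 1 => //; move=> z _; exact: Hc.
    by rewrite -mulrDl subrK.
  have xy0 : 0 < enorm (x - y).
    rewrite lt_neqAle enorm_ge0 andbT eq_sym; apply: contra_neq xy => h.
    apply/eqP; rewrite -subr_eq0; apply/eqP/rowP => j.
    rewrite [RHS]mxE; apply/eqP; rewrite -normr_le0.
    by apply: le_trans (coord_le_enorm _ _) _; rewrite h.
  pose g := (c - c0) * enorm (x - y).
  (* The slack [g] is spent in quarters: one for each of the two images, and one for each of the two
     points in the comparison of [x - y] with [x' - y']. *)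
  have g40 : 0 < g / 4 by rewrite divr_gt0 // mulr_gt0 // subr_gt0.
  have [d1 d10 H1] := fiber_cont b x Da0 g40.
  have [d2 d20 H2] := fiber_cont b y Da0 g40.
  pose d3 := g / 4 / n.+1%:R; have d30 : 0 < d3 by rewrite divr_gt0.
  pose del := Num.min d1 (Num.min d2 d3).
  have del0 : 0 < del by rewrite !lt_min d10 d20.
  have dd1 : del <= d1 by rewrite ge_min lexx.
  have dd2 : del <= d2 by rewrite !ge_min lexx orbT.
  have dd3 : del <= d3 by rewrite !ge_min lexx !orbT.
  pose U (z : 'rV[R]_n) := [set y : 'rV[R]_n | forall j, `|y 0 j - z 0 j| < del].
  have UE z z' : U z z' -> enorm (z' - z) <= g / 4.
    move=> Uz; apply: le_trans (natM_div_succ_le n (ltW g40)).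
    apply: enorm_le_coord => j; rewrite !mxE; apply: le_trans dd3.
    by rewrite ltW.
  exists (U x `*` U y), 0, del; split => //.
    by exists (U x, U y) => //=; split; apply/nbhs_rVP; exists del.
  move=> s a [x' y'] _ Da aa [/= Ux Uy].
  have F1 : enorm (f b a x' - f b a0 x) <= g / 4.
    by apply: H1 => // j; [exact: lt_le_trans (aa j) dd1|exact: lt_le_trans (Ux j) dd1].
  have F2 : enorm (f b a y' - f b a0 y) <= g / 4.
    by apply: H2 => // j; [exact: lt_le_trans (aa j) dd2|exact: lt_le_trans (Uy j) dd2].
  have F3 := Hc b x y.
  have G1 := UE _ _ Ux; have G2 := UE _ _ Uy.
  have T1 := ler_enorm_dist (f b a x') (f b a0 x) (f b a y').
  have T2 := ler_enorm_dist (f b a0 x) (f b a0 y) (f b a y').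
  have T3 := ler_enorm_dist x x' y; have T4 := ler_enorm_dist x' y' y.
  rewrite (enormB (f b a0 y)) in T2; rewrite (enormB x x') in T3.
  have T5 : c * enorm (x - y) <= c * enorm (x' - y') + g / 2.
    have : c * enorm (x - y) <= c * (enorm (x' - y') + g / 2).
      rewrite ler_wpM2l //; lra.
    have : c * (g / 2) <= g / 2 by rewrite ger_pMl ?ltW // divr_gt0 //; lra.
    rewrite mulrDr; lra.
  rewrite /g in F1 F2 G1 G2 T5; lra.
apply: filterS Hs => a Ha x y xr yr; exact: (Ha (x, y)).
Qed.

End LocalContraction.

(** * Limits of derivatives *)

Section Limits.
Context {R : realType}.

Lemma cauchy_dist_cvg (u : nat -> R) :
  (forall e : R, 0 < e -> exists N, forall m p, (N <= m)%N ->
    `|u (m + p)%N - u m| <= e) -> cvg (u @ \oo).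
Proof.
move=> H; apply/cauchy_cvgP/cauchy_exP => e e0.
have [|N HN] := H (e / 2); first by rewrite divr_gt0.
exists (u N); exists N => // m /= /subnKC <-.
rewrite /ball /= distrC; apply: le_lt_trans (HN _ _ (leqnn N)) _.
by rewrite ltr_pdivrMr // ltr_pMr // ltr1n.
Qed.

Lemma cvg_norm_le (u : nat -> R) (l M : R) (N : nat) : u @ \oo --> l ->
  (forall m, (N <= m)%N -> `|u m| <= M) -> `|l| <= M.
Proof.
move=> ul H; apply/ler_addgt0Pr => e e0.
have /cvgrPdist_le/(_ e e0)[N' _ HN'] := ul.
rewrite -[l](subrK (u (maxn N N'))) addrC; apply: le_trans (ler_normD _ _) _.
rewrite addrC [M + e]addrC; apply: lerD; first by apply: HN'; exact: leq_maxr.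
by apply: H; exact: leq_maxl.
Qed.

Context {d : nat}.
Variables (D : set 'rV[R]_d) (p : 'rV[R]_d).
Hypotheses (Dp : D p).

Lemma near_within_point (P : 'rV[R]_d -> Prop) :
  (\forall a \near within D (nbhs p), P a) -> P p.
Proof. by move/nbhs_singleton; apply. Qed.

Lemma ucauchy_cvg (I : Type) (u : I -> nat -> 'rV[R]_d -> R) i :
  ucauchy (within D (nbhs p)) u -> cvg (u i m p @[m --> \oo]).
Proof.
move=> uc; apply: cauchy_dist_cvg => e e0; have [N /near_within_point HN] := uc e e0.
by exists N => m q; exact: HN.
Qed.

Variables (u : nat -> 'rV[R]_d -> R) (v : 'rV[R]_d -> R).
Hypothesis uv : forall q, D q -> u m q @[m --> \oo] --> v q.

Lemma cont_limit : (forall m, cont_on D (u m)) ->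
  ucauchy (within D (nbhs p)) (fun _ : unit => u) ->
  v q @[q --> within D (nbhs p)] --> v p.
Proof.
move=> uc ucau; apply/cvgrPdist_le => e e0.
have e30 : 0 < e / 3 by rewrite divr_gt0.
have [N HN] := ucau _ e30.
have tail q : D q -> (forall (i : unit) (m j : nat), (N <= m)%N ->
    `|u (m + j)%N q - u m q| <= e / 3) -> `|v q - u N q| <= e / 3.
  move=> Dq Hq; apply: (@cvg_norm_le (fun m => u m q - u N q) _ _ N).
    by apply: cvgB; [exact: uv|exact: cvg_cst].
  by move=> m /subnKC <-; exact: (Hq tt).
have Dn : \forall q \near within D (nbhs p), D q by exact: withinT.
have := uc N p Dp => /cvgrPdist_le/(_ _ e30) HC.
have Hp := near_within_point HN.
apply: filterS3 HN Dn HC => q HNq Dq Hq.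
have /ler_normlP[? ?] := tail p Dp Hp; have /ler_normlP[? ?] := tail q Dq HNq.
by move: Hq => /ler_normlP[? ?]; apply/ler_normlP; split; lra.
Qed.

(** The mean value theorem is applied to [u m - u N], whose derivative is small along the whole
    segment; then [m] tends to infinity with [h] fixed. The derivative of the single function [u N]
    absorbs the rest. *)
Lemma is_pderiv_limit i (u' : nat -> 'rV[R]_d -> R) (v' : R) : axis_convex D ->
  (forall m q, D q -> is_pderiv D i (u m) q (u' m q)) ->
  ucauchy (within D (nbhs p)) (fun _ : unit => u') ->
  u' m p @[m --> \oo] --> v' -> is_pderiv D i v p v'.
Proof.
move=> DC uu' ucau uv'; apply/is_pderivP => e e0.
have e30 : 0 < e / 3 by rewrite divr_gt0.
have [N HN] := ucau _ e30; have Hp := near_within_point HN.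
have /nbhs_rVP[d1 d10 H1] := HN.
have /is_pderivP/(_ _ e30)[d2 d20 H2] := uu' N p Dp.
exists (Num.min d1 d2) => [|h]; first by rewrite lt_min d10.
rewrite lt_min => /andP[h1 h2] Dh.
apply: (@cvg_norm_le (fun m => u m (p + h *: delta_mx 0 i) - u m p - h * u' m p) _ _ N).
  by apply: cvgB; [apply: cvgB; exact: uv|apply: cvgM => //; exact: cvg_cst].
move=> m Nm; have := H2 h h2 Dh.
(* The difference is written with a constant factor [- 1], so that the sum and product rules give
   its derivative. *)
have [|t /andP[t0 t1]] := @axis_MVT _ _ D i (fun q => u m q + - 1 * u N q)
    (fun q => u' m q + (0 * u N q + - 1 * u' N q)) p h DC _ Dp Dh.
  by move=> q Dq; apply: is_pderivD; [|apply: is_pderivM; [exact: is_pderiv_cst|]]; exact: uu'.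
set q := p + (t * h) *: _.
have Dq : D q by apply: DC => //; rewrite t0.
have A1 : `|u' m q - u' N q| <= e / 3.
  move: Nm => /subnKC <-; apply: (H1 q) => // j.
  rewrite /q !mxE eqxx /= addrAC subrr add0r; apply: le_lt_trans h1.
  case: (j == i); rewrite ?mulr0 ?normr0 // mulr1 normrM ler_piMl //.
  by rewrite ger0_norm.
have A2 : `|u' m p - u' N p| <= e / 3.
  by move: Nm => /subnKC <-; exact: (Hp tt).
have A3 : `|h * (u' m q - u' N q)| <= e / 3 * `|h|.
  by rewrite normrM mulrC ler_wpM2r.
have A4 : `|h * (u' m p - u' N p)| <= e / 3 * `|h|.
  by rewrite normrM mulrC ler_wpM2r.
move=> E A5.
have -> : u m (p + h *: delta_mx 0 i) - u m p - h * u' m p =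
  h * (u' m q - u' N q) - h * (u' m p - u' N p) +
  (u N (p + h *: delta_mx 0 i) - u N p - h * u' N p).
  have : h * (u' m q - u' N q) = h * (u' m q + (0 * u N q + - 1 * u' N q)) by ring.
  by move=> ->; rewrite -E; ring.
have -> : e * `|h| = e / 3 * `|h| + e / 3 * `|h| + e / 3 * `|h|.
  by rewrite -!mulrDl; congr (_ * _); field.
apply: le_trans (ler_normD _ _) _; apply: lerD => //.
by apply: le_trans (ler_normB _ _) _; exact: lerD.
Qed.

End Limits.

(** * Derivatives of a composition *)

Section Expressions.
Context {R : realType} {k n : nat} {B : finType}.
Variables (r : nat) (f : B -> 'rV[R]_k -> 'rV[R]_n -> 'rV[R]_n).
Hypotheses (r_gt0 : (0 < r)%N) (f_IFS : parametrized_IFS r f).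

Notation C := (cube R k).
Notation D := (cylinder n C).

(** Polynomials in the derivatives of order at most [q] of the map along [x] and of order at most
    [p] of [x]. The two bounds are separate because the lower terms of the recursion contain
    derivatives of [f] of full order, but derivatives of [x] of smaller order only. One expression
    serves all maps [c] and all functions [x], in particular all iterates. *)
Inductive expr (q p : nat) :
    (B -> ('rV[R]_k -> 'rV[R]_n) -> 'rV[R]_k -> R) -> Prop :=
| expr_map w l of (size w <= q)%N :
    expr q p (fun c x a => pderivs D w (total_map f c) (row_mx a (x a)) 0 l)
| expr_var t l of (size t <= p)%N : expr q p (fun _ x a => pderivs C t x a 0 l)
| expr_zero : expr q p (fun _ _ _ => 0)
| expr_add P Q of expr q p P & expr q p Q :
    expr q p (fun c x a => P c x a + Q c x a)
| expr_mul P Q of expr q p P & expr q p Q :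
    expr q p (fun c x a => P c x a * Q c x a).

Lemma expr_le q p q' p' P : (q <= q')%N -> (p <= p')%N -> expr q p P -> expr q' p' P.
Proof.
move=> qq pp; elim=> [w l wq|t l tp||? ? ? ? ? ?|? ? ? ? ? ?].
- by apply: expr_map; exact: leq_trans wq qq.
- by apply: expr_var; exact: leq_trans tp pp.
- exact: expr_zero.
- exact: expr_add.
- exact: expr_mul.
Qed.

Lemma expr_sum (J : Type) (s : seq J) q p P : (forall j, expr q p (P j)) ->
  expr q p (fun c x a => \sum_(j <- s) P j c x a).
Proof.
move=> H; elim: s => [|j s IH].
  rewrite (_ : (fun _ _ _ => _) = fun _ _ _ => 0); first exact: expr_zero.
  by apply/funext => c; apply/funext => x; apply/funext => a; rewrite big_nil.
rewrite (_ : (fun _ _ _ => _) =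
    fun c x a => P j c x a + \sum_(j <- s) P j c x a); first exact: expr_add.
by apply/funext => c; apply/funext => x; apply/funext => a; rewrite big_cons.
Qed.

Lemma is_pderiv_total_map w i l c p : (size w < r)%N -> D p ->
  is_pderiv D i (fun p => pderivs D w (total_map f c) p 0 l) p
    (pderivs D (i :: w) (total_map f c) p 0 l).
Proof. exact: (Cr_is_pderiv (total_map_Cr f_IFS c)). Qed.

Lemma cont_on_total_map w l c : (size w <= r)%N ->
  cont_on D (fun p => pderivs D w (total_map f c) p 0 l).
Proof. exact: (Cr_cont_on (total_map_Cr f_IFS c)). Qed.

Lemma is_pderiv_map_comp w i l c (x : 'rV[R]_k -> 'rV[R]_n) a :
  Cr r C x -> (size w < r)%N -> C a ->
  is_pderiv C i (fun a => pderivs D w (total_map f c) (row_mx a (x a)) 0 l) a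
    (pderivs D (lshift n i :: w) (total_map f c) (row_mx a (x a)) 0 l +
     \sum_j pderivs C [:: i] x a 0 j *
       pderivs D (rshift k j :: w) (total_map f c) (row_mx a (x a)) 0 l).
Proof.
move=> xr wr Ca.
apply: (@chain_rule _ _ _ C (fun p => pderivs D w (total_map f c) p 0 l)
   (fun j p => pderivs D (rshift k j :: w) (total_map f c) p 0 l)
   cube_axis_convex) => //.
- by move=> q j Dq; exact: is_pderiv_total_map.
- by move=> j; exact: cont_on_total_map.
- by apply: is_pderiv_total_map => //; rewrite cylinder_row_mx.
- by move=> j; exact: (@Cr_is_pderiv _ _ _ _ _ _ [::] i a j xr r_gt0 Ca).
Qed.

(** Each differentiation raises both orders by at most one, by the chain and product rules. The
    expression [Q] is chosen before [c], [x] and [a]. *)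
Lemma expr_is_pderiv q p P i : (q < r)%N -> (p < r)%N -> expr q p P ->
  exists2 Q, expr q.+1 p.+1 Q & forall c x a, Cr r C x -> C a ->
    is_pderiv C i (P c x) a (Q c x a).
Proof.
move=> qr pr; elim=> [w l wq|t l tp||P1 P2 e1 [Q1 E1 H1] e2 [Q2 E2 H2]
    |P1 P2 e1 [Q1 E1 H1] e2 [Q2 E2 H2]].
- exists (fun c x a => pderivs D (lshift n i :: w) (total_map f c) (row_mx a (x a)) 0 l +
     \sum_j pderivs C [:: i] x a 0 j *
       pderivs D (rshift k j :: w) (total_map f c) (row_mx a (x a)) 0 l).
    apply: expr_add; first exact: expr_map.
    by apply: expr_sum => j; apply: expr_mul; [exact: expr_var|exact: expr_map].
  by move=> c x a xr Ca; apply: is_pderiv_map_comp => //; exact: leq_ltn_trans wq qr.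
- exists (fun c x a => pderivs C (i :: t) x a 0 l); first exact: expr_var.
  by move=> c x a xr Ca; apply: Cr_is_pderiv xr _ Ca; exact: leq_ltn_trans tp pr.
- exists (fun _ _ _ => 0); first exact: expr_zero.
  by move=> c x a xr Ca; exact: is_pderiv_cst.
- exists (fun c x a => Q1 c x a + Q2 c x a); first exact: expr_add.
  by move=> c x a xr Ca; apply: is_pderivD; [exact: H1|exact: H2].
- have [e1' e2'] := (expr_le (leqnSn q) (leqnSn p) e1, expr_le (leqnSn q) (leqnSn p) e2).
  exists (fun c x a => Q1 c x a * P2 c x a + P1 c x a * Q2 c x a).
    by apply: expr_add; exact: expr_mul.
  by move=> c x a xr Ca; apply: is_pderivM; [exact: H1|exact: H2].
Qed.

Lemma expr_cont q p P c x : (q <= r)%N -> (p <= r)%N -> expr q p P ->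
  Cr r C x -> cont_on C (P c x).
Proof.
move=> qr pr + xr; elim=> [w l wq|t l tp||P1 P2 _ H1 _ H2|P1 P2 _ H1 _ H2].
- move=> a Ca; apply/cvgrPdist_le => e e0.
  have wr := leq_trans wq qr.
  have [del del0 Hd] := cont_on_row_mx (x a) (@cont_on_total_map w l c wr) Ca e0.
  have nD : \forall q \near within C (nbhs a), C q by exact: withinT.
  have nx : \forall q \near within C (nbhs a), forall j, `|x q 0 j - x a 0 j| < del.
    apply: filter_forall => j.
    have /cvgrPdist_lt/(_ del del0) := @Cr_cont_on _ _ _ _ _ _ [::] j xr (leq0n _) a Ca.
    by apply: filterS => b; rewrite distrC.
  have na : \forall q \near within C (nbhs a), forall j : 'I_k, `|(q : 'rV[R]_k) 0 j - a 0 j| < del.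
    by apply/nbhs_rVP; exists del.
  by apply: filterS3 nD nx na => b Cb xb ab; rewrite distrC; exact: Hd.
- by apply: Cr_cont_on xr _; exact: leq_trans tp pr.
- by move=> a Ca; exact: cvg_cst.
- exact: cont_onD.
- exact: cont_onM.
Qed.

Lemma jet_pderivs (a0 : 'rV[R]_k) t : (size t <= r)%N -> exists s, forall x : 'rV[R]_k -> 'rV[R]_n,
  row s (jet r a0 x) = pderivs C t x a0.
Proof.
rewrite -ltnS => tr.
pose s : jet_index k r := @Tagged 'I_r.+1 (Ordinal tr)
  (fun j : 'I_r.+1 => (j.-tuple 'I_k : Type)) (in_tuple t).
by exists (enum_rank s) => x; apply/rowP => l; rewrite !mxE enum_rankK.
Qed.

(** This is the reason why the action on jets does not depend on the representative. *)
Lemma expr_jet q p P c a0 x y : (p <= r)%N -> expr q p P ->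
  jet r a0 x = jet r a0 y -> P c x a0 = P c y a0.
Proof.
move=> pr + xy; have E t : (size t <= r)%N -> pderivs C t x a0 = pderivs C t y a0.
  by move=> /(jet_pderivs a0)[s Hs]; rewrite -!Hs xy.
elim=> [w l wq|t l tp||P1 P2 _ -> _ ->|P1 P2 _ -> _ ->] //.
  by have /= -> := E [::] (leq0n _).
by rewrite E // (leq_trans tp).
Qed.

(** The formula of Faa di Bruno in qualitative form: its coefficients are irrelevant, only its
    polynomial shape and its orders matter. *)
Lemma comp_expr s l : (size s <= r)%N -> exists2 P, expr (size s) (size s) P &
  forall c x a, Cr r C x -> C a ->
    pderivs C s (fun a => f c a (x a)) a 0 l = P c x a.
Proof.
elim: s l => [|i s IH] l sr.
  exists (fun c x a => pderivs D [::] (total_map f c) (row_mx a (x a)) 0 l).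
    exact: expr_map.
  by move=> c x a _ _; rewrite /= total_map_row_mx.
have /choice[Q HQ] : forall l, exists Q, expr (size s).+1 (size s).+1 Q /\
    forall c x a, Cr r C x -> C a ->
      is_pderiv C i (fun q => pderivs C s (fun a => f c a (x a)) q 0 l) a (Q c x a).
  move=> l'; have [P eP HP] := IH l' (ltnW sr).
  have [Q eQ HQ] := expr_is_pderiv i sr sr eP; exists Q; split => // c x a xr Ca.
  by apply: eq_is_pderiv Ca (HQ c x a xr Ca) => q Cq; rewrite HP.
exists (Q l); first by have [] := HQ l.
move=> c x a xr Ca /=.
rewrite (@pderivE _ _ _ _ _ _ _ (\row_l Q l c x a) cube_axis_thick Ca) ?mxE //.
by move=> j; rewrite mxE; have [_] := HQ j; exact.
Qed.

Lemma comp_is_pderiv s i l c x a : (size s < r)%N -> Cr r C x -> C a ->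
  is_pderiv C i (fun q => pderivs C s (fun a => f c a (x a)) q 0 l) a
    (pderivs C (i :: s) (fun a => f c a (x a)) a 0 l).
Proof.
move=> sr xr Ca.
have H j : exists Q, is_pderiv C i (fun q => pderivs C s (fun a => f c a (x a)) q 0 j) a Q.
  have [P eP HP] := comp_expr j (ltnW sr).
  have [Q eQ HQ] := expr_is_pderiv i sr sr eP; exists (Q c x a).
  by apply: eq_is_pderiv Ca (HQ c x a xr Ca) => q Cq; rewrite HP.
have /choice[Q HQ] := H.
rewrite /= (@pderivE _ _ _ _ _ _ _ (\row_l Q l) cube_axis_thick Ca) ?mxE //.
by move=> j; rewrite mxE.
Qed.

Lemma comp_Cr c x : Cr r C x -> Cr r C (fun a => f c a (x a)).
Proof.
move=> xr; apply: Cr_intro => [s j sr|s i p j sr Cp]; last exact: comp_is_pderiv.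
have [P eP HP] := comp_expr j sr.
apply: (eq_cont_on _ (expr_cont sr sr eP xr)) => q Cq; symmetry; exact: HP.
Qed.

Lemma is_pderiv_sum (J : Type) (s : seq J) i (g : J -> 'rV[R]_k -> R) p dg :
  (forall j, is_pderiv C i (g j) p (dg j)) ->
  is_pderiv C i (fun q => \sum_(j <- s) g j q) p (\sum_(j <- s) dg j).
Proof.
move=> H; elim: s => [|j s IH].
  rewrite big_nil (_ : (fun _ => _) = fun=> 0); first exact: is_pderiv_cst.
  by apply/funext => q; rewrite big_nil.
rewrite big_cons (_ : (fun _ => _) = fun q => g j q + \sum_(j <- s) g j q).
  exact: is_pderivD.
by apply/funext => q; rewrite big_cons.
Qed.

(* The derivative of top order of x enters linearly, through the fiber Jacobian;
   this is what makes the action on jets a skew contraction. *)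
Lemma comp_leading_term i s l : (size s < r)%N ->
  exists2 P, expr (size s).+1 (size s) P & forall c x a, Cr r C x -> C a ->
    pderivs C (i :: s) (fun a => f c a (x a)) a 0 l =
    (pderivs C (i :: s) x a *m fiber_jacobian f c (row_mx a (x a))) 0 l + P c x a.
Proof.
have J c x a m : fiber_jacobian f c (row_mx a (x a)) m l =
    pderivs D [:: rshift k m] (total_map f c) (row_mx a (x a)) 0 l by rewrite mxE.
elim: s i => [|j s IH] i sr.
  exists (fun c x a => pderivs D [:: lshift n i] (total_map f c) (row_mx a (x a)) 0 l).
    exact: expr_map.
  move=> c x a xr Ca.
  have H := @is_pderiv_map_comp [::] i l c x a xr r_gt0 Ca.
  rewrite addrC mxE; under eq_bigr do rewrite J.
  refine (is_pderiv_unique cube_axis_thick Ca (comp_is_pderiv (s := [::]) r_gt0 xr Ca) _).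
  by refine (eq_is_pderiv _ Ca H) => q Cq; rewrite /= total_map_row_mx.
have [P eP HP] := IH j (ltnW sr).
have [P' eP' HP'] := expr_is_pderiv i sr (ltnW sr) eP.
have r1 : (1 < r)%N by exact: leq_ltn_trans sr.
have /choice[K HK] : forall m, exists K, expr 2 1 K /\ forall c x a, Cr r C x -> C a ->
    is_pderiv C i (fun a => fiber_jacobian f c (row_mx a (x a)) m l) a (K c x a).
  move=> m; have [|K eK HK] := @expr_is_pderiv 1 0 (fun c x a =>
      pderivs D [:: rshift k m] (total_map f c) (row_mx a (x a)) 0 l) i r1 r_gt0.
    exact: expr_map.
  exists K; split => // c x a xr Ca.
  by apply: eq_is_pderiv Ca (HK c x a xr Ca) => q _; rewrite J.
(* Differentiating the previous leading term by the product rule gives the new leading term when the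
   derivative falls on [x]; when it falls on the Jacobian, the result [K] joins the lower terms. *)
exists (fun c x a => \sum_m pderivs C (j :: s) x a 0 m * K m c x a + P' c x a).
  apply: expr_add; last exact: eP'.
  apply: expr_sum => m; apply: expr_mul; first exact: expr_var.
  have [eK _] := HK m; exact: (@expr_le 2 1 _ _ _ _ _ eK).
move=> c x a xr Ca.
have H : is_pderiv C i (fun q => \sum_m pderivs C (j :: s) x q 0 m *
    fiber_jacobian f c (row_mx q (x q)) m l + P c x q) a
  (\sum_m (pderivs C (i :: j :: s) x a 0 m * fiber_jacobian f c (row_mx a (x a)) m l
     + pderivs C (j :: s) x a 0 m * K m c x a) + P' c x a).
  apply: is_pderivD; last exact: HP'.
  apply: is_pderiv_sum => m; apply: is_pderivM; first exact: (Cr_is_pderiv xr sr Ca).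
  by have [_] := HK m; exact.
rewrite mxE addrA -big_split /=.
refine (is_pderiv_unique cube_axis_thick Ca (comp_is_pderiv sr xr Ca) _).
by refine (eq_is_pderiv _ Ca H) => q Cq; rewrite HP // mxE.
Qed.

End Expressions.

(** * Jets of the branches *)

Section Branches.
Context {R : realType} {k n : nat} {B : finType}.
Variables (r : nat) (f : B -> 'rV[R]_k -> 'rV[R]_n -> 'rV[R]_n).
Hypotheses (r_gt0 : (0 < r)%N) (f_IFS : parametrized_IFS r f).

Notation C := (cube R k).
Notation D := (cylinder n C).

Definition seq_shift (b : nat -> B) : nat -> B := fun i => b i.+1.

Lemma branchS (T : Type) (F : B -> T -> T) b x m :
  branch F b x m.+1 = F (b 0%N) (branch F (seq_shift b) x m).
Proof. by rewrite /branch /= -[1%N]/(1 + 0)%N iotaDl foldr_map. Qed.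

Definition Xbranch (b : nat -> B) (m : nat) (a : 'rV[R]_k) : 'rV[R]_n :=
  branch (fun c => f c a) b 0 m.

Lemma XbranchS b m a : Xbranch b m.+1 a = f (b 0%N) a (Xbranch (seq_shift b) m a).
Proof. exact: branchS. Qed.

Lemma pderivs_zero s a l : C a -> pderivs C s (fun=> (0 : 'rV[R]_n)) a 0 l = 0.
Proof.
elim: s a l => [|i s IH] a l Ca; first by rewrite /= mxE.
rewrite /= (@pderivE _ _ _ _ _ _ _ 0 cube_axis_thick Ca) ?mxE // => j.
rewrite mxE; refine (eq_is_pderiv _ Ca (is_pderiv_cst _ _ 0 _)).
by move=> q Cq; rewrite IH.
Qed.

Lemma Cr_zero : Cr r C (fun=> (0 : 'rV[R]_n)).
Proof.
apply: Cr_intro => [s j sr|s i p j sr Cp].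
  apply: (@eq_cont_on _ _ _ (fun=> 0)) => [q Cq|p Cp]; last exact: cvg_cst.
  by rewrite pderivs_zero.
rewrite pderivs_zero //; refine (eq_is_pderiv _ Cp (is_pderiv_cst _ _ 0 _)).
by move=> q Cq; rewrite pderivs_zero.
Qed.

Lemma Xbranch0 b : Xbranch b 0 = fun=> 0. Proof. by []. Qed.

Lemma XbranchS_fun b m :
  Xbranch b m.+1 = fun a => f (b 0%N) a (Xbranch (seq_shift b) m a).
Proof. by apply/funext => a; rewrite XbranchS. Qed.

Lemma Xbranch_Cr b m : Cr r C (Xbranch b m).
Proof.
elim: m b => [|m IH] b; first exact: Cr_zero.
by rewrite XbranchS_fun; exact: comp_Cr.
Qed.

Section LocalUniformity.
Variable a0 : 'rV[R]_k.
Hypothesis Ca0 : C a0.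
Notation W := (within C (nbhs a0)).

Lemma near_cube : \forall a \near W, C a.
Proof. exact: withinT. Qed.

Lemma eq_ubc (I : Type) (u v : I -> nat -> 'rV[R]_k -> R) :
  (forall a, C a -> forall i m, u i m a = v i m a) -> ubc W u -> ubc W v.
Proof.
move=> uv [[M HM] H]; split.
  by exists M; apply: filterS2 near_cube HM => a Ca Ha i m; rewrite -uv.
move=> e e0; have [N HN] := H e e0; exists N.
by apply: filterS2 near_cube HN => a Ca Ha i m p Nm; rewrite -!uv //; exact: Ha.
Qed.

(** The case of the empty word. The recursion is not affine at this level, but contraction on the
    invariant ball directly yields the geometric bound [c ^+ m * (2 * rho)]. *)
Lemma Xbranch_uniform : exists rho c : R, [/\ 0 <= c < 1,
  \forall a \near W, forall b m, enorm (Xbranch b m a) <= rho,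
  \forall a \near W, forall b m z,
    enorm (z *m fiber_jacobian f (b 0%N) (row_mx a (Xbranch (seq_shift b) m a)))
      <= c * enorm z &
  forall l, ubc W (fun b m a => Xbranch b m a 0 l)].
Proof.
have [rho [c [rho0 c01 Hnear]]] := local_contraction r_gt0 f_IFS Ca0.
have /andP[c0 c1] := c01.
have inball a : (forall b x, enorm x <= rho -> enorm (f b a x) < rho) ->
    forall b m, enorm (Xbranch b m a) < rho.
  move=> H b m; elim: m b => [|m IH] b; first by rewrite Xbranch0 enorm0.
  by rewrite XbranchS; apply: H; exact: ltW.
exists rho, c; split => //.
- by apply: filterS Hnear => a Ha b m; apply/ltW/inball => b' x; have [+ _] := Ha b'; exact.
- apply: filterS2 near_cube Hnear => a Ca Ha b m z.
  set x := Xbranch (seq_shift b) m a.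
  have xr : enorm x < rho by apply: inball => b' y; have [+ _] := Ha b'; exact.
  apply: (fiber_jacobian_norm r_gt0 f_IFS Ca).
  (* The iterates stay strictly inside the ball, which leaves room for a neighbourhood of [x] where
     [c] is a Lipschitz constant and thus bounds the Jacobian. *)
  exists ((rho - enorm x) / n.+1%:R); first by rewrite divr_gt0 // subr_gt0.
  move=> y yx; have [_ H] := Ha (b 0%N); apply: H; last exact: ltW.
  rewrite -[y](subrK x); apply: le_trans (ler_enormD _ _) _; rewrite -lerBrDr.
  apply: le_trans (natM_div_succ_le n _); last by rewrite subr_ge0 ltW.
  by apply: enorm_le_coord => j; rewrite !mxE; exact: ltW.
- move=> l; split.
    exists rho; apply: filterS Hnear => a Ha b m.
    apply: le_trans (coord_le_enorm _ _) _; apply/ltW/inball => b' x.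
    by have [+ _] := Ha b'; exact.
  move=> e e0.
  have : (fun j => c ^+ j * (2 * rho)) @ \oo --> 0 * (2 * rho).
    by apply: cvgM; [apply: cvg_expr; rewrite ger0_norm|exact: cvg_cst].
  rewrite mul0r => /cvgrPdist_le/(_ _ e0)[N _ /(_ _)HN]; exists N.
  apply: filterS Hnear => a Ha b m p Nm.
  have ball b' m' : enorm (Xbranch b' m' a) <= rho.
    by apply/ltW/inball => b'' x; have [+ _] := Ha b''; exact.
  have := HN m Nm; rewrite /= sub0r normrN => /(le_trans (ler_norm _)); apply: le_trans.
  have -> : Xbranch b (m + p) a 0 l - Xbranch b m a 0 l =
      (Xbranch b (m + p) a - Xbranch b m a) 0 l by rewrite !mxE.
  apply: le_trans (coord_le_enorm _ _) _ => {Nm}.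
  elim: m b => [|m IH] b.
    rewrite expr0 mul1r; apply: le_trans (ler_enormB _ _) _.
    by rewrite mulr2n mulrDl mul1r lerD.
  rewrite addSn !XbranchS exprS -mulrA.
  have [_ H] := Ha (b 0%N); apply: le_trans (H _ _ _ _) _ => //.
  by rewrite ler_wpM2l.
Qed.

Lemma expr_ubc q p P : (q <= r)%N -> expr f q p P ->
  (forall t l, (size t <= p)%N ->
    ubc W (fun b m a => pderivs C t (Xbranch b m) a 0 l)) ->
  ubc W (fun b m a => P (b 0%N) (Xbranch (seq_shift b) m) a).
Proof.
move=> qr + H; have [rho [c [_ Hrho _ X0]]] := Xbranch_uniform.
elim=> [w l wq|t l tp||P1 P2 _ H1 _ H2|P1 P2 _ H1 _ H2].
- apply: (@ubc_comp _ k n C a0 B (nat -> B) (fun b => b 0%N) _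
    (fun c q => pderivs D w (total_map f c) q 0 l)
    (fun b m a => Xbranch (seq_shift b) m a) Ca0 (@compact_eball R n rho)).
  + by move=> c'; exact: (@cont_on_total_map _ _ _ _ r f f_IFS w l c' (leq_trans wq qr)).
  + by apply: filterS Hrho => a Ha b m; exact: Ha.
  + by move=> j; exact: (ubc_reindex seq_shift (X0 j)).
- exact: (ubc_reindex seq_shift (H t l tp)).
- exact: ubc_cst.
- exact: ubcD.
- exact: ubcM.
Qed.

(** Induction on the length: the Jacobian along the iterates depends on [X_m] alone and the
    remainder on shorter words, so both converge uniformly and [recursion_ubc] applies. *)
Lemma pderivs_Xbranch_ubc s l : (size s <= r)%N ->
  ubc W (fun b m a => pderivs C s (Xbranch b m) a 0 l).
Proof.
have [rho [c [/andP[c0 c1] _ HJ X0]]] := Xbranch_uniform.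
(* The induction bears on a bound for the length, since the lower terms involve arbitrary shorter
   words and not only suffixes of [s]. *)
elim: {s}(size s) {-2}s (leqnn (size s)) l => [|N IH] [|i s] // sN l sr;
  try exact: X0.
have IHs t l' : (size t <= size s)%N ->
    ubc W (fun b m a => pderivs C t (Xbranch b m) a 0 l').
  move=> ts; apply: IH; first exact: leq_trans ts sN.
  exact: leq_trans ts (ltnW sr).
apply: (@recursion_ubc _ _ n W _ (nat -> B) seq_shift
  (fun b m a => pderivs C (i :: s) (Xbranch b m) a)
  (fun b m a => fiber_jacobian f (b 0%N) (row_mx a (Xbranch (seq_shift b) m a))) c) => //.
- apply: filterS near_cube => a Ca b; apply/rowP => j.
  by rewrite Xbranch0 pderivs_zero // mxE.
- move=> j l'.
  have := @expr_ubc 1 0 _ r_gt0 (@expr_map _ _ _ _ f 1 0 [:: rshift k j] l' isT).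
  move=> /(_ (fun t l' t0 => IHs t l' (leq_trans t0 (leq0n _)))).
  by apply: eq_ubc => a Ca b m; rewrite mxE.
- move=> l'; have [P eP HP] := comp_leading_term r_gt0 f_IFS i l' sr.
  apply: eq_ubc (expr_ubc sr eP IHs) => a Ca b m.
  rewrite [RHS]mxE [X in _ = _ + X]mxE XbranchS_fun HP //; last exact: Xbranch_Cr.
  by rewrite addrAC subrr add0r.
Qed.

End LocalUniformity.

Lemma ubc_at (u : (nat -> B) -> nat -> 'rV[R]_k -> R) (a : 'rV[R]_k) b :
  ubc (within C (nbhs a)) u -> ucauchy (within C (nbhs a)) (fun _ : unit => u b).
Proof.
by move=> [_ H] e e0; have [N HN] := H e e0; exists N; apply: filterS HN => q Hq _; exact: Hq.
Qed.

(** [Xlim] is a pointwise limit, which settles the empty word. Each further letter exchanges limit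
    and derivative, using convergence on the whole cube for the shorter word and the uniform Cauchy
    property for the longer one. *)
Lemma pderivs_Xbranch_cvg b s a l : (size s <= r)%N -> C a ->
  pderivs C s (Xbranch b m) a 0 l @[m --> \oo] --> pderivs C s (Xlim f b) a 0 l.
Proof.
have cv t p j : (size t <= r)%N -> C p ->
    cvg (pderivs C t (Xbranch b m) p 0 j @[m --> \oo]).
  move=> tr Cp; have [_ H] := pderivs_Xbranch_ubc Cp j tr.
  exact: (ucauchy_cvg Cp (i := b) H).
elim: s a l => [|i s IH] a l sr Ca.
  pose v : 'rV[R]_n := \row_j lim (Xbranch b m a 0 j @[m --> \oo]).
  have : Xbranch b m a @[m --> \oo] --> v.
    by apply/cvg_mxP => i j; rewrite ord1 mxE; exact: (cv [::]).
  move=> H; have -> : pderivs C [::] (Xlim f b) a = v by exact: cvg_lim.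
  by move/cvg_mxP: H; exact.
have D' j : is_pderiv C i (fun q => pderivs C s (Xlim f b) q 0 j) a
    (lim (pderivs C (i :: s) (Xbranch b m) a 0 j @[m --> \oo])).
  apply: (@is_pderiv_limit _ _ C a Ca
    (fun m q => pderivs C s (Xbranch b m) q 0 j) _ _ i
    (fun m q => pderivs C (i :: s) (Xbranch b m) q 0 j)).
  - by move=> q Cq; apply: IH => //; exact: ltnW.
  - exact: cube_axis_convex.
  - by move=> m q Cq; exact: (Cr_is_pderiv (Xbranch_Cr b m) sr Cq).
  - exact: (ubc_at b (pderivs_Xbranch_ubc (s := i :: s) Ca j sr)).
  - exact: cv.
rewrite [pderivs C (i :: s) (Xlim f b) a](@pderivE _ _ _ _ _ _ _
  (\row_j lim (pderivs C (i :: s) (Xbranch b m) a 0 j @[m --> \oo])) cube_axis_thick Ca).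
  by rewrite mxE; exact: cv.
by move=> j; rewrite mxE.
Qed.

Lemma Xlim_Cr b : Cr r C (Xlim f b).
Proof.
apply: Cr_intro => [s j sr|s i p j sr Cp].
  move=> p Cp; apply: (@cont_limit _ _ C p Cp (fun m q => pderivs C s (Xbranch b m) q 0 j)).
  - by move=> q Cq; exact: pderivs_Xbranch_cvg.
  - by move=> m; exact: (Cr_cont_on (Xbranch_Cr b m)).
  - exact: (ubc_at b (pderivs_Xbranch_ubc Cp j sr)).
apply: (@is_pderiv_limit _ _ C p Cp
    (fun m q => pderivs C s (Xbranch b m) q 0 j) _ _ i
    (fun m q => pderivs C (i :: s) (Xbranch b m) q 0 j)).
- by move=> q Cq; apply: pderivs_Xbranch_cvg => //; exact: ltnW.
- exact: cube_axis_convex.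
- by move=> m q Cq; exact: (Cr_is_pderiv (Xbranch_Cr b m) sr Cq).
- exact: (ubc_at b (pderivs_Xbranch_ubc (s := i :: s) Cp j sr)).
- exact: (pderivs_Xbranch_cvg (s := i :: s)).
Qed.

Variable a0 : 'rV[R]_k.
Hypothesis Ca0 : C a0.

Lemma word_size (s : jet_index k r) : (size (tagged s) <= r)%N.
Proof. by rewrite size_tuple -ltnS. Qed.

(** The representative picked by [jet_repr] has the same jet as [x], and the derivatives of the
    composition at [a0] are polynomials in that jet. *)
Lemma jet_action_jet c x : Cr r C x ->
  jet_action r a0 (f c) (jet r a0 x) = jet r a0 (fun a => f c a (x a)).
Proof.
move=> xr; rewrite /jet_action.
have [|yr yx] := @xgetPex _ (fun=> 0) [set y | Cr r C y /\ jet r a0 y = jet r a0 x].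
  by exists x.
rewrite -/(jet_repr r a0 (jet r a0 x)) in yr yx *.
apply/matrixP => s l; rewrite !mxE.
have [P eP HP] := comp_expr r_gt0 f_IFS l (word_size (enum_val s)).
by rewrite !HP //; exact: expr_jet (word_size _) eP yx.
Qed.

Lemma branch_jet_action b m :
  branch (fun c => jet_action r a0 (f c)) b (0 : jet_array R k n r) m =
  jet r a0 (Xbranch b m).
Proof.
elim: m b => [|m IH] b.
  (* The zero array is the jet of the zero function, which is the iterate of order 0. *)
  by apply/matrixP => s l; rewrite Xbranch0 !mxE pderivs_zero.
by rewrite branchS IH jet_action_jet ?XbranchS_fun //; exact: Xbranch_Cr.
Qed.

Lemma branch_jet_action_cvg b :
  branch (fun c => jet_action r a0 (f c)) b (0 : jet_array R k n r) m
    @[m --> \oo] --> jet r a0 (Xlim f b).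
Proof.
under eq_fun do rewrite branch_jet_action.
apply/cvg_mxP => s l; rewrite mxE; under eq_fun do rewrite mxE.
by apply: pderivs_Xbranch_cvg => //; exact: word_size.
Qed.

End Branches.

Theorem proposition8 (R : realType) (k n r : nat)
    (k_gt0 : (0 < k)%N) (n_gt0 : (0 < n)%N) (r_gt0 : (0 < r)%N)
    (B : finType) (f : B -> 'rV[R]_k -> 'rV[R]_n -> 'rV[R]_n)
    (f_IFS : parametrized_IFS r f) (a0 : 'rV[R]_k) (a0_cube : cube R k a0) :
  (forall b : nat -> B, exists2 J : jet_array R k n r,
      jet_space r a0 J &
      branch (fun c => jet_action r a0 (f c)) b (0 : jet_array R k n r) m
        @[m --> \oo] --> J) /\
  jet_Lambda r a0 f =
    limit_set (fun c => jet_action r a0 (f c)) (0 : jet_array R k n r).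
Proof.
have cv b := branch_jet_action_cvg r_gt0 f_IFS a0_cube b.
split=> [b|].
  exists (jet r a0 (Xlim f b)); last exact: cv.
  by exists (Xlim f b) => //; exact: Xlim_Cr.
apply/seteqP; split=> [_ [b _ <-]|J [b bJ]]; first by exists b; exact: cv.
exists b => //; apply/matrixP => s l.
have /cvg_mxP X_cvg := cv b; have /cvg_mxP J_cvg := bJ.
(* Uniqueness of limits is applied entrywise, in [R]. *)
exact: cvg_unique (X_cvg s l) (J_cvg s l).
Qed.
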